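(* Let $\mathcal{H}$ be a Hilbert space, $T>0$, and let $C\colon[0,T]\rightrightarrows\mathcal{H}$ be a set-valued map with nonempty closed values such that, for some constant $L_C\ge 0$, $d_H(C(t),C(s))\le L_C|t-s|$ for all $t,s\in[0,T]$. Let $F\colon[0,T]\times\mathcal{H}\rightrightarrows\mathcal{H}$ be a set-valued map with nonempty, closed and convex values such that: (H1) for all $t\in[0,T]$, $F(t,\cdot)$ is upper semicontinuous from $\mathcal{H}$ into $\mathcal{H}_w$; (H2) there is a Lipschitz continuous function $h\colon\mathcal{H}\to\mathbb{R}^+$ (with constant $L_h>0$) such that $\inf\{\|w\|:w\in F(t,x)\}\le h(x)$ for all $x\in\mathcal{H}$ and a.e. $t\in[0,T]$; (H3) there are $\gamma>0$ and a map $f\colon[0,T]\times\mathcal{H}\to\mathcal{H}$ such that $f(t,x)\in\operatorname{proj}^{\gamma}_{F(t,x)}(0)$ for all $(t,x)\in[0,T]\times\mathcal{H}$ and $f(\cdot,x)$ is measurable for all $x\in\mathcal{H}$. Suppose in addition that the family $(C(t))_{t\in[0,T]}$ is equi-uniformly subsmooth and that the sets $C(t)$ are ball-compact for all $t\in[0,T]$. Let $x_0\in C(0)$. Then the sequence of continuous functions $(x_n)_n$ generated by the catching-up algorithm with approximate projections (defined in the context) converges uniformly on $[0,T]$, up to a subsequence, to an absolutely continuous function $x$, which is a solution of $$\dot{x}(t)\in -N(C(t);x(t))+F(t,x(t))\ \text{ for a.e. }t\in[0,T],\qquad x(0)=x_0.$$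
   Context: $\mathbb{B}$ is the closed unit ball of $\mathcal{H}$; $\mathcal{H}_w$ is $\mathcal{H}$ with the weak topology. For $S\subset\mathcal{H}$, $d_S(x)=\inf_{z\in S}\|x-z\|$. The Hausdorff distance is $d_H(A,B)=\max\{\sup_{x\in A}d_B(x),\sup_{x\in B}d_A(x)\}$. A set-valued map $G\colon\mathcal{H}\rightrightarrows\mathcal{H}$ is upper semicontinuous from $\mathcal{H}$ into $\mathcal{H}_w$ if $\{x: G(x)\cap D\neq\emptyset\}$ is closed for every weakly closed $D\subset\mathcal{H}$. A set $S$ is ball-compact if $S\cap r\mathbb{B}$ is compact for all $r>0$. Approximate projections: for $\varepsilon>0$, $\operatorname{proj}^{\varepsilon}_S(x)=\{z\in S:\|x-z\|^2<d_S^2(x)+\varepsilon\}$. Clarke normal cone: for $x\in S$, the Clarke tangent cone $T(S;x)$ is the set of $v\in\mathcal{H}$ such that for every sequence $(x_n)$ in $S$ converging to $x$ and every sequence of positive numbers $(t_n)$ converging to $0$ there is $(v_n)$ converging to $v$ with $x_n+t_nv_n\in S$ for all $n$; $N(S;x)=\{w:\langle w,v\rangle\le0\ \forall v\in T(S;x)\}$ for $x\in S$, and $N(S;x)=\emptyset$ if $x\notin S$. Equi-uniform subsmoothness: a family $(S(t))_{t\in I}$ of closed sets is equi-uniformly subsmooth if for every $\varepsilon>0$ there is $\delta>0$ such that for all $t\in I$, $\langle\xi_2-\xi_1,x_2-x_1\rangle\ge-\varepsilon\|x_2-x_1\|$ whenever $x_1,x_2\in S(t)$, $\|x_1-x_2\|\le\delta$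 and $\xi_i\in N(S(t);x_i)\cap\mathbb{B}$ for $i\in\{1,2\}$. A solution of the differential inclusion is an absolutely continuous $x\colon[0,T]\to\mathcal{H}$ satisfying the inclusion for a.e. $t$ and the initial condition. Catching-up algorithm with approximate projections: for $n\ge1$ let $\mu_n=T/n$ and $t_k^n=k\mu_n$ for $k=0,\dots,n$. Let $(\varepsilon_n)_n$ be a sequence of positive numbers with $\varepsilon_n/\mu_n^2\to0$. Let $f$ and $\gamma$ be as in (H3). Put $x_0^n=x_0$ and choose, for $k\in\{0,\dots,n-1\}$, any $$x_{k+1}^n\in\operatorname{proj}^{\varepsilon_n}_{C(t_{k+1}^n)}\Big(x_k^n+\int_{t_k^n}^{t_{k+1}^n}f(s,x_k^n)\,ds\Big).$$ Define $x_n(0)=x_0$ and, for $t\in\,]t_k^n,t_{k+1}^n]$, $$x_n(t)=x_k^n+\frac{t-t_k^n}{\mu_n}\Big(x_{k+1}^n-x_k^n-\int_{t_k^n}^{t_{k+1}^n}f(s,x_k^n)\,ds\Big)+\int_{t_k^n}^tf(s,x_k^n)\,ds.$$ Integrals are Bochner integrals, and measurability of $f(\cdot,x)$ is understood in the (strong) sense making them meaningful. *)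

(* Defs.v *)
From mathcomp Require Import all_boot all_order all_algebra.
From mathcomp Require Import all_classical all_reals all_analysis.

Set Implicit Arguments.
Unset Strict Implicit.
Unset Printing Implicit Defensive.

Import Order.TTheory GRing.Theory Num.Theory.
Import numFieldNormedType.Exports.

Local Open Scope classical_set_scope.
Local Open Scope ring_scope.

(** Real Hilbert spaces are rendered as a [H : completeNormedModType R] together
    with a MathComp inner product [dot : {dot H for idfun}] (a symmetric positive
    definite bilinear form) inducing the norm. *)
Definition induces_norm (R : realType) (H : completeNormedModType R)
    (dot : {dot H for idfun}) : Prop :=
  forall x : H, `|x| ^+ 2 = dot x x.

(** Distances, the excess of one set over another and the Hausdorff distance are
    extended-real valued: with the conventions of [ereal_inf] and [ereal_sup] no
    nonemptiness or boundedness assumption is needed for the definitions. *)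
Definition dist (R : realType) (H : normedModType R) (S : set H) (x : H)
    : \bar R :=
  ereal_inf [set `|x - z|%:E | z in S].

Definition excess (R : realType) (H : normedModType R) (A B : set H) : \bar R :=
  ereal_sup [set dist B x | x in A].

Definition hausdorff_dist (R : realType) (H : normedModType R) (A B : set H)
    : \bar R :=
  maxe (excess A B) (excess B A).

Definition approx_proj (R : realType) (H : normedModType R) (e : R)
    (S : set H) (x : H) : set H :=
  [set z | S z /\ ((`|x - z| ^+ 2)%:E < dist S x ^+ 2 + e%:E)%E].

Definition ball_compact (R : realType) (H : normedModType R) (S : set H) : Prop :=
  forall r : R, 0 < r -> compact (S `&` [set x | `|x| <= r]).

Definition topological_dual (R : realType) (H : normedModType R) : Type :=
  {l : {linear H -> R^o} | continuous l}.

(** The weak topology is the supremum of the initial topologies of the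
    continuous linear functionals. *)
Definition weak_space (R : realType) (H : normedModType R) : Type :=
  @sup_topology H (topological_dual H)
    (fun l => Topological.class (initial_topology (sval l : H -> R^o))).

Definition weakly_closed (R : realType) (H : normedModType R) (D : set H)
    : Prop :=
  closed (D : set (weak_space H)).

Definition usc_strong_weak (R : realType) (H : normedModType R)
    (G : H -> set H) : Prop :=
  forall D : set H, weakly_closed D -> closed [set x | G x `&` D !=set0].

Definition clarke_tangent_cone (R : realType) (H : normedModType R)
    (S : set H) (x : H) : set H :=
  [set v | forall (y : nat -> H) (t : nat -> R),
    (forall n, S (y n)) -> y @ \oo --> x ->
    (forall n, 0 < t n) -> t @ \oo --> 0 ->
    exists2 w : nat -> H, w @ \oo --> v & forall n, S (y n + t n *: w n)].

Definition clarke_normal_cone (R : realType) (H : completeNormedModType R)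
    (dot : {dot H for idfun}) (S : set H) (x : H) : set H :=
  [set w | S x /\ forall v, clarke_tangent_cone S x v -> dot w v <= 0].

Definition equi_uniformly_subsmooth (R : realType) (H : completeNormedModType R)
    (dot : {dot H for idfun}) (I : set R) (S : R -> set H) : Prop :=
  forall e : R, 0 < e -> exists2 delta : R, 0 < delta &
    forall t, I t -> forall x1 x2 xi1 xi2 : H,
      S t x1 -> S t x2 -> `|x1 - x2| <= delta ->
      clarke_normal_cone dot (S t) x1 xi1 -> `|xi1| <= 1 ->
      clarke_normal_cone dot (S t) x2 xi2 -> `|xi2| <= 1 ->
      dot (xi2 - xi1) (x2 - x1) >= - e * `|x2 - x1|.

Definition simple_vfun d (X : measurableType d) (R : realType)
    (H : normedModType R) (s : X -> H) : Prop :=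
  finite_set (range s) /\ forall y, measurable (s @^-1` [set y]).

(** The restriction [y != 0] matters only when [D] has infinite measure. *)
Definition integrable_simple_vfun d (X : measurableType d) (R : realType)
    (H : normedModType R) (mu : {measure set X -> \bar R}) (D : set X)
    (s : X -> H) : Prop :=
  simple_vfun s /\
  forall y, y != 0 -> (mu (D `&` s @^-1` [set y]) < +oo)%E.

Definition simple_vintegral d (X : measurableType d) (R : realType)
    (H : normedModType R) (mu : {measure set X -> \bar R}) (D : set X)
    (s : X -> H) : H :=
  \sum_(y \in range s) fine (mu (D `&` s @^-1` [set y])) *: y.

(** The limit is only required almost everywhere, so that for the Lebesgue
    measure on the Borel sigma-algebra this is strong measurability in the
    Lebesgue sense (and not in the more restrictive Borel sense). *)
Definition strongly_measurable d (X : measurableType d) (R : realType)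
    (H : normedModType R) (mu : {measure set X -> \bar R}) (D : set X)
    (g : X -> H) : Prop :=
  exists2 s : nat -> X -> H, (forall n, simple_vfun (s n)) &
    {ae mu, forall t, D t -> s n t @[n --> \oo] --> g t}.

Definition has_bochner_integral d (X : measurableType d) (R : realType)
    (H : completeNormedModType R) (mu : {measure set X -> \bar R}) (D : set X)
    (g : X -> H) (v : H) : Prop :=
  strongly_measurable mu D g /\
  exists s : nat -> X -> H,
    [/\ forall n, integrable_simple_vfun mu D (s n),
        (\int[mu]_(t in D) `|s n t - g t|%:E)%E @[n --> \oo] --> 0%E &
        simple_vintegral mu D (s n) @[n --> \oo] --> v].

(** Junk value [0] when [g] is not Bochner integrable. *)
Definition bochner_integral d (X : measurableType d) (R : realType)
    (H : completeNormedModType R) (mu : {measure set X -> \bar R}) (D : set X)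
    (g : X -> H) : H :=
  xget 0 [set v | has_bochner_integral mu D g v].

Definition integral_itv (R : realType) (H : completeNormedModType R) (a b : R)
    (g : R -> H) : H :=
  bochner_integral (@lebesgue_measure R) `[a, b] g.

Definition absolutely_continuous (R : realType) (H : normedModType R)
    (a b : R) (x : R -> H) : Prop :=
  forall e : R, 0 < e -> exists2 delta : R, 0 < delta &
    forall (m : nat) (u v : 'I_m -> R),
      (forall i, a <= u i /\ u i <= v i /\ v i <= b) ->
      trivIset [set: 'I_m] (fun i => `]u i, v i[%classic) ->
      \sum_(i < m) (v i - u i) < delta ->
      \sum_(i < m) `|x (v i) - x (u i)| < e.

(** Only the values of [x] on [[0, T]] matter: the endpoints, where [derivable]
    looks outside the interval, form a null set. *)
Definition sweeping_solution (R : realType) (H : completeNormedModType R)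
    (dot : {dot H for idfun}) (T : R) (C : R -> set H) (F : R -> H -> set H)
    (x0 : H) (x : R -> H) : Prop :=
  [/\ absolutely_continuous 0 T x,
      {ae @lebesgue_measure R, forall t : R, t \in `[0, T] ->
        derivable x t 1 /\
        [set - xi + w | xi in clarke_normal_cone dot (C t) (x t)
                      & w in F t (x t)] (derive1 x t)} &
      x 0 = x0].

Definition time_step (R : realType) (T : R) (n : nat) : R := T / n%:R.

Definition time_node (R : realType) (T : R) (n k : nat) : R :=
  k%:R * time_step T n.

(** [z n k] is the discrete iterate and [xn n] the interpolation; the stage
    [n = 0] is unconstrained. *)
Definition catching_up (R : realType) (H : completeNormedModType R) (T : R)
    (C : R -> set H) (f : R -> H -> H) (eps : nat -> R) (x0 : H)
    (z : nat -> nat -> H) (xn : nat -> R -> H) : Prop :=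
  let mu := time_step T in
  let tau := time_node T in
  forall n, (0 < n)%N ->
  [/\ z n 0%N = x0,
      (forall k, (k < n)%N ->
         approx_proj (eps n) (C (tau n k.+1))
           (z n k + integral_itv (tau n k) (tau n k.+1) (f ^~ (z n k)))
           (z n k.+1)),
      xn n 0 = x0 &
      forall k t, (k < n)%N -> t \in `]tau n k, tau n k.+1] ->
        xn n t = z n k
          + ((t - tau n k) / mu n) *:
              (z n k.+1 - z n k
               - integral_itv (tau n k) (tau n k.+1) (f ^~ (z n k)))
          + integral_itv (tau n k) t (f ^~ (z n k))].

(* Main.v *)
From HB Require Import structures.
Require Import Defs.
From mathcomp Require Import all_boot all_order all_algebra finmap.
From mathcomp Require Import all_classical all_reals all_analysis.
From mathcomp Require Import measurable_realfun ring lra.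

(** Along the catching-up polygon x_n the velocity is phi_n - zeta_n up to a small
    error, where the step functions phi_n and zeta_n approximate the selection
    f(t, x_k^n) and the projection residual divided by the time step.  By
    ball-compactness and equi-Lipschitz bounds, x_n converges uniformly along an
    ultrafilter, hence along a subsequence, to a Lipschitz curve x.

    No weak compactness is used for the velocities.  Instead one takes elements
    (G_j, Z_j) of the midpoint hulls of the tails of (phi_n, zeta_n) which nearly
    minimise the L^2 norm; the parallelogram identity makes them Cauchy in L^2, so
    along fast indices they converge almost everywhere, strongly, to some (g, zeta).
    Since the hulls preserve the approximate primitive relation, x is a primitive of
    g - zeta, and Lebesgue's differentiation theorem gives x' = g - zeta.

    Both memberships are then pointwise and pass through the hulls because they are
    tested on half-spaces: g(t) lies in F(t, x(t)) by strict separation and upper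
    semicontinuity applied to a weakly closed half-space.  For zeta(t), an approximate
    projection z of y on C is close to an exact projection w of the midpoint of y and
    z, which provides a normal vector close to y - z; subsmoothness, compared with the
    zero normal at the other point, makes such normals uniformly Frechet, and this
    property survives the limit. *)

Set Implicit Arguments.
Unset Strict Implicit.
Unset Printing Implicit Defensive.

Import Order.TTheory GRing.Theory Num.Theory.
Import numFieldNormedType.Exports.

Local Open Scope classical_set_scope.
Local Open Scope ring_scope.

(** * Real inner products *)

(** The growth bound [h] is only Lipschitz, so nothing is bounded a priori: a discrete Gronwall
    inequality confines the iterates and yields one speed constant for all step sizes. Dividing by
    the step turns the projection tolerance into a velocity error of order
    [Num.sqrt (eps n / m ^+ 2)], which is why this ratio has to vanish.

    The selection is evaluated at the current time [t] and only its state argument is frozen, so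
    upper semicontinuity of [F t] is used at fixed [t]. The normals live at the later node; the
    equi-uniform modulus and the Lipschitz motion of [C] carry them back to [t].

    Vector integrals are reduced to scalar ones by testing against a vector with [dot], and [f] is
    replaced on each cell by a finite-valued function, so that hull elements stay finite-valued. The
    price is an exceptional set where the replacement is far from [f]; its measure is kept below a
    dyadic term, so that almost every [t] eventually leaves these sets. The two velocity components
    are minimised as a pair, since the same midpoints must act on both for their difference to
    remain the velocity. *)

Section dot_theory.
Context (R : realType) (H : completeNormedModType R) (dot : {dot H for idfun}).
Implicit Types x y z : H.

Lemma dotC x y : dot x y = dot y x.
Proof. by rewrite hermC expr0 mul1r. Qed.

Lemma dotDl x y z : dot (x + y) z = dot x z + dot y z.
Proof. exact: linearDl. Qed.

Lemma dotDr x y z : dot z (x + y) = dot z x + dot z y.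
Proof. exact: linearDr. Qed.

Lemma dotNl x z : dot (- x) z = - dot x z.
Proof. exact: linearNl. Qed.

Lemma dotNr x z : dot z (- x) = - dot z x.
Proof. exact: linearNr. Qed.

Lemma dotZl a x z : dot (a *: x) z = a * dot x z.
Proof. exact: linearZl_LR. Qed.

Lemma dotZr a x z : dot z (a *: x) = a * dot z x.
Proof. by rewrite dotC dotZl dotC. Qed.

Lemma dot0l x : dot 0 x = 0.
Proof. exact: linear0l. Qed.

Lemma dot0r x : dot x 0 = 0.
Proof. exact: linear0r. Qed.

Lemma dotBl x y z : dot (x - y) z = dot x z - dot y z.
Proof. by rewrite dotDl dotNl. Qed.

Lemma dotBr x y z : dot z (x - y) = dot z x - dot z y.
Proof. by rewrite dotDr dotNr. Qed.

Definition dotE := (dotDl, dotDr, dotBl, dotBr, dotNl, dotNr, dotZl, dotZr,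
  dot0l, dot0r).

Hypothesis hdot : induces_norm dot.

Lemma sqr_normD x y : `|x + y| ^+ 2 = `|x| ^+ 2 + 2 * dot x y + `|y| ^+ 2.
Proof. by rewrite !hdot !dotE (dotC y x); ring. Qed.

Lemma sqr_normB x y : `|x - y| ^+ 2 = `|x| ^+ 2 - 2 * dot x y + `|y| ^+ 2.
Proof. by rewrite !hdot !dotE (dotC y x); ring. Qed.

Lemma parallelogram x y :
  `|x + y| ^+ 2 + `|x - y| ^+ 2 = 2 * `|x| ^+ 2 + 2 * `|y| ^+ 2.
Proof. by rewrite sqr_normD sqr_normB; ring. Qed.

Lemma cauchy_schwarz x y : `|dot x y| <= `|x| * `|y|.
Proof.
have [->|x0] := eqVneq x 0; first by rewrite dot0l !normr0 mul0r.
have x2 : 0 < `|x| by rewrite normr_gt0.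
rewrite -ler_sqr ?nnegrE ?mulr_ge0// exprMn real_normK ?num_real//.
(* Up to scaling this vector is the component of [y] orthogonal to [x]; its squared norm is
   [|x|^2 (|x|^2 |y|^2 - (dot x y)^2)]. *)
have : 0 <= `|dot x y *: x - (`|x| ^+ 2) *: y| ^+ 2 by rewrite sqr_ge0.
rewrite sqr_normB !normrZ !dotE !exprMn !real_normK ?num_real//.
set a := dot x y; set b := `|x| ^+ 2; set c := `|y| ^+ 2 => h.
have b0 : 0 < b by rewrite exprn_gt0.
have {}h : 0 <= b * (b * c - a ^+ 2) by move: h; congr (0 <= _); ring.
by rewrite -subr_ge0; rewrite pmulr_rge0 in h.
Qed.

Lemma dot_le x y : dot x y <= `|x| * `|y|.
Proof. exact: le_trans (ler_norm _) (cauchy_schwarz _ _). Qed.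

Lemma dot_ge x y : - (`|x| * `|y|) <= dot x y.
Proof. by have := cauchy_schwarz x y; rewrite ler_norml => /andP[]. Qed.

Lemma dot_continuous y : continuous (fun x => dot x y : R^o).
Proof.
move=> x; apply/cvgrPdist_le => /= e e0.
near=> t.
rewrite -dotBl; apply: le_trans (cauchy_schwarz _ _) _.
apply: le_trans (_ : `|x - t| * (`|y| + 1) <= _).
  by rewrite ler_wpM2l// lerDl.
rewrite -ler_pdivlMr ?ltr_wpDl//.
near: t; have /cvgrPdist_le := @cvg_id H (nbhs x) : id @ x --> x.
by apply; rewrite divr_gt0// ltr_wpDl.
Unshelve. all: by end_near. Qed.

Lemma cvg_dotl T (F : set_system T) {FF : Filter F} (u : T -> H) x y :
  u @ F --> x -> (fun t => dot (u t) y) @ F --> dot x y.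
Proof. by move=> ux; exact: (continuous_cvg FF (@dot_continuous y x) ux). Qed.

Lemma le_norm_dot x c : 0 <= c -> (forall v, dot x v <= c * `|v|) -> `|x| <= c.
Proof.
move=> c0 h; have [->|x0] := eqVneq x 0; first by rewrite normr0.
by have := h x; rewrite -hdot expr2 ler_pM2r ?normr_gt0.
Qed.

(** Apollonius' identity. The sum of the squared distances from [x] to [y] and [z] depends on [x]
    only through its distance to their midpoint, so both have the same minimisers. *)
Lemma sqr_norm_midpoint x y z :
  `|y - x| ^+ 2 + `|z - x| ^+ 2 =
  2 * `|2^-1 *: (y + z) - x| ^+ 2 + 2^-1 * `|y - z| ^+ 2.
Proof.
rewrite !sqr_normB !normrZ !dotE exprMn sqr_normD normfV ger0_norm//.
by field.
Qed.

End dot_theory.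

(** * Measurability and integration of vector-valued functions *)

Section finite_valued.
Context d (X : measurableType d).

(** The body of [simple_vfun] with an arbitrary codomain, so that pairs, booleans and reals are
    covered as well. All preimages are then measurable, and composition with any map stays in the
    class. *)
Definition finite_valued (V : Type) (s : X -> V) : Prop :=
  finite_set (range s) /\ forall y, measurable (s @^-1` [set y]).

Lemma finite_valued_preimage V (s : X -> V) (B : set V) :
  finite_valued s -> measurable (s @^-1` B).
Proof.
move=> [fs ms].
have -> : s @^-1` B = \bigcup_(y in range s `&` B) s @^-1` [set y].
  apply/seteqP; split=> t /=; first by move=> Bt; exists (s t).
  by move=> [y [_ By] ->].
by apply: fin_bigcup_measurable => // ; exact: finite_setIl.
Qed.

Lemma finite_valued_comp V W (g : V -> W) (s : X -> V) :
  finite_valued s -> finite_valued (g \o s).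
Proof.
move=> fs; split; last by move=> y; exact: (finite_valued_preimage (g @^-1` [set y]) fs).
by rewrite -(image_comp s g); apply: finite_image; exact: fs.1.
Qed.

Lemma finite_valued_pair V W (s : X -> V) (r : X -> W) :
  finite_valued s -> finite_valued r -> finite_valued (fun t => (s t, r t)).
Proof.
move=> [fs ms] [fr mr]; split.
  apply: (@sub_finite_set _ _ (range s `*` range r)); last exact: finite_setX.
  by move=> _ [t _ <-]; split; exists t.
move=> [y z].
have -> : (fun t => (s t, r t)) @^-1` [set (y, z)] =
    s @^-1` [set y] `&` r @^-1` [set z].
  apply/seteqP; split=> t /=; first by case=> -> ->.
  by case=> -> ->.
exact: measurableI.
Qed.

Lemma finite_valued_comp2 V W U (g : V -> W -> U) (s : X -> V) (r : X -> W) :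
  finite_valued s -> finite_valued r -> finite_valued (fun t => g (s t) (r t)).
Proof.
move=> fs fr; have := finite_valued_pair fs fr.
exact: (@finite_valued_comp _ _ (fun p => g p.1 p.2)).
Qed.

Lemma finite_valued_cst V (v : V) : finite_valued (fun _ : X => v).
Proof.
split.
  apply: (@sub_finite_set _ _ [set v]); last exact: finite_set1.
  by move=> _ [t _ <-].
move=> y; have [->|vy] := pselect (v = y).
  by rewrite [X in measurable X](_ : _ = setT)//; apply/seteqP; split.
by rewrite [X in measurable X](_ : _ = set0)//; apply/seteqP; split.
Qed.

Lemma finite_valued_mem (A : set X) :
  measurable A -> finite_valued (fun t => t \in A).
Proof.
move=> mA; split; first exact: finite_finset.
case.
  rewrite [X in measurable X](_ : _ = A)//; apply/seteqP; split=> t /=.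
    by move=> /set_mem.
  exact: mem_set.
rewrite [X in measurable X](_ : _ = ~` A); first exact: measurableC.
by apply/seteqP; split=> t /=; [move/negbT; rewrite notin_setE|rewrite -notin_setE => /negbTE].
Qed.

Lemma finite_valued_if V (A : set X) (s r : X -> V) : measurable A ->
  finite_valued s -> finite_valued r ->
  finite_valued (fun t => if t \in A then s t else r t).
Proof.
move=> mA fs fr.
have := finite_valued_comp2 (fun b (p : V * V) => if b then p.1 else p.2)
  (finite_valued_mem mA) (finite_valued_pair fs fr).
by [].
Qed.

Lemma finite_valued_measurable (R : realType) (s : X -> R) :
  finite_valued s -> measurable_fun setT s.
Proof. by move=> fs _ B mB; rewrite setTI; exact: finite_valued_preimage. Qed.

End finite_valued.

Section simple_limit.
Context d (X : measurableType d) (R : realType) (H : normedModType R).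
Implicit Types g : X -> H.

(** Convergence is required everywhere, in contrast with [strongly_measurable]: scalar functions of
    [g] are then measurable for the given sigma-algebra, without a null set to discuss. *)
Definition simple_limit g : Prop :=
  exists2 s : nat -> X -> H, (forall n, finite_valued (s n)) &
    forall t, s n t @[n --> \oo] --> g t.

Lemma simple_limit_finite g : finite_valued g -> simple_limit g.
Proof. by move=> fg; exists (fun=> g) => // t; exact: cvg_cst. Qed.

Lemma simple_limitD g1 g2 : simple_limit g1 -> simple_limit g2 ->
  simple_limit (fun t => g1 t + g2 t).
Proof.
move=> [s fs sg] [r fr rg]; exists (fun n t => s n t + r n t).
  by move=> n; exact: (finite_valued_comp2 (fun x y : H => x + y)).
by move=> t; exact: cvgD.
Qed.

Lemma simple_limitN g : simple_limit g -> simple_limit (fun t => - g t).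
Proof.
move=> [s fs sg]; exists (fun n t => - s n t).
  by move=> n; exact: (finite_valued_comp (fun x : H => - x)).
by move=> t; exact: cvgN.
Qed.

Lemma simple_limitB g1 g2 : simple_limit g1 -> simple_limit g2 ->
  simple_limit (fun t => g1 t - g2 t).
Proof. by move=> h1 h2; apply: simple_limitD h1 (simple_limitN h2). Qed.

Lemma simple_limit_measurable (k : H -> R) g : continuous (k : H -> R^o) ->
  simple_limit g -> measurable_fun setT (k \o g).
Proof.
move=> ck [s fs sg].
apply: (@measurable_realfun.measurable_fun_cvg _ _ _ _ (fun n t => k (s n t))).
  by move=> n; exact/finite_valued_measurable/(finite_valued_comp k).
by move=> t _; exact: (continuous_cvg _ (ck (g t)) (sg t)).
Qed.

Lemma simple_limit_norm g : simple_limit g -> measurable_fun setT (fun t => `|g t|).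
Proof. by move=> gl; apply: (@simple_limit_measurable (fun x : H => `|x|)) gl;
  exact: norm_continuous. Qed.

(** The values of the approximating functions form a countable set, and every [g t] is a limit of
    such values. This separability reduces vector differentiation to countably many scalar ones. *)
Lemma simple_limit_dense g : simple_limit g ->
  exists Y : nat -> H, forall t e, 0 < e -> exists n, `|g t - Y n| < e.
Proof.
move=> [s fs sg].
have cY : countable (\bigcup_n range (s n)).
  apply: bigcup_countable => // n _; apply: finite_set_countable; exact: (fs n).1.
have /countable_injP[i iinj] := cY.
pose Y n := xget 0 [set y | (\bigcup_n range (s n)) y /\ i y = n].
exists Y => t e e0.
have /cvgrPdist_lt/(_ _ e0)[n _ /(_ n (leqnn n)) hn] := sg t.
exists (i (s n t)).
suff -> : Y (i (s n t)) = s n t by exact: hn.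
have sY : (\bigcup_n range (s n)) (s n t) by exists n => //; exists t.
have [Yn iY] : [set y | (\bigcup_n range (s n)) y /\ i y = i (s n t)] (Y (i (s n t))).
  by rewrite /Y; case: xgetP => [y _ //|/(_ (s n t))]; case.
by apply: iinj => //; exact/mem_set.
Qed.

End simple_limit.

(** * Scalar integrals of bounded functions on sets of finite measure *)

Section bounded_integrals.
Import HBNNSimple.
Context d (X : measurableType d) (R : realType) (mu : {measure set X -> \bar R}).
Context (D : set X) (mD : measurable D) (finD : (mu D < +oo)%E).
Implicit Types p q : X -> R.

Lemma bounded_integrable p M : measurable_fun setT p ->
  (forall t, `|p t| <= M) -> mu.-integrable D (EFin \o p).
Proof.
move=> mp pM; apply: measurable_bounded_integrable => //.
  exact: measurable_funS mp.
by exists M; split; rewrite ?num_real// => r Mr t _ /=; apply: le_trans (pM t) (ltW Mr).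
Qed.

Lemma EFin_Rintegral p : mu.-integrable D (EFin \o p) ->
  (\int[mu]_(t in D) p t)%:E = (\int[mu]_(t in D) (p t)%:E)%E.
Proof. by move=> ip; rewrite /Rintegral fineK//; exact: (integrable_fin_num mD ip). Qed.

Lemma le_Rintegral_bound p M : mu.-integrable D (EFin \o p) ->
  (forall t, D t -> p t <= M) -> \int[mu]_(t in D) p t <= M * fine (mu D).
Proof.
move=> ip pM; rewrite -(Rintegral_cst mu mD); apply: le_Rintegral => //.
apply: (@bounded_integrable _ `|M|) => //; exact: measurable_cst.
Qed.

Lemma bounded_Rintegral_cvg (p_ : nat -> X -> R) p M :
  (forall n, measurable_fun setT (p_ n)) -> measurable_fun setT p ->
  (forall n t, `|p_ n t| <= M) ->
  {ae mu, forall t, D t -> p_ n t @[n --> \oo] --> p t} ->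
  \int[mu]_(t in D) p_ n t @[n --> \oo] --> \int[mu]_(t in D) p t.
Proof.
move=> mp_ mp pM pp.
have iM : mu.-integrable D (EFin \o cst M).
  by apply: (@bounded_integrable _ `|M|) => //; exact: measurable_cst.
have [ip _ h] : [/\ mu.-integrable D (EFin \o p),
    (\int[mu]_(t in D) `|(p_ n t)%:E - (p t)%:E|)%E @[n --> \oo] --> 0%E &
    (\int[mu]_(t in D) (p_ n t)%:E)%E @[n --> \oo] --> (\int[mu]_(t in D) (p t)%:E)%E].
  apply: (@dominated_convergence _ _ _ mu D mD (fun n t => (p_ n t)%:E) _ (EFin \o cst M)) => //.
  - by move=> n; apply/measurable_EFinP; exact: measurable_funS (mp_ n).
  - by apply/measurable_EFinP; exact: measurable_funS mp.
  - by apply: filterS pp => t ppt Dt; apply: cvg_EFin (ppt Dt); exact: nearW.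
  - by apply: aeW => t n Dt /=; rewrite lee_fin.
apply: (@fine_cvg _ _ _ _ (fun n => \int[mu]_(t in D) (p_ n t)%:E)%E).
by rewrite /Rintegral fineK//; exact: (integrable_fin_num mD ip).
Qed.

(** Only [g] is assumed measurable: in the application [k] is the norm of [s n - f], where [f] is
    merely an almost everywhere limit of simple functions. The integral is a supremum over simple
    functions; one lying below [k] is almost everywhere below [g], and one lying below [g] off the
    null set is below [k]. *)
Lemma ge0_ae_eq_integral_ge0 (k g : X -> \bar R) :
  (forall t, D t -> 0 <= k t)%E -> (forall t, D t -> 0 <= g t)%E ->
  measurable_fun D g -> {ae mu, forall t, D t -> k t = g t} ->
  (\int[mu]_(t in D) k t = \int[mu]_(t in D) g t)%E.
Proof.
move=> k0 g0 mg [N [mN N0 kgN]].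
have kg t : D t -> ~ N t -> k t = g t.
  by move=> Dt Nt; apply: contrapT => kgt; apply/Nt/kgN => /= /(_ Dt).
have Dk (f : {nnsfun X >-> R}) : measurable_fun D (fun t => (f t)%:E).
  by apply/measurable_EFinP; apply: measurable_funTS; exact: measurable_funP.
apply/eqP; rewrite eq_le; apply/andP; split.
  rewrite ge0_integralE//; apply: ge_ereal_sup => _ [f /= fk <-].
  rewrite -integralT_nnsfun.
  have -> : (\int[mu]_t (f t)%:E = \int[mu]_(t in D) (f t)%:E)%E.
    rewrite [RHS]integral_mkcond; apply: eq_integral => t _ /=.
    rewrite /patch; case: ifPn => //; rewrite notin_setE => Dt.
    have := fk t; rewrite /patch memNset// lee_fin => ft.
    by apply/eqP; rewrite eqe eq_le ft/=; exact: fun_ge0.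
  apply: ae_ge0_le_integral => //.
  - by move=> t _; rewrite lee_fin; exact: fun_ge0.
  - exists N; split => // t /= h; apply: contrapT => Nt; apply: h => Dt.
    by rewrite -kg//; have := fk t; rewrite /patch mem_set.
have -> : (\int[mu]_(t in D) g t = \int[mu]_(t in D `\` N) g t)%E.
  rewrite (@ge0_negligible_integral _ _ _ mu D N)// => t Dt; exact: g0.
rewrite [leLHS]ge0_integralE; last by move=> t [/g0].
apply: ge_ereal_sup => _ [f /= fg <-].
rewrite ge0_integralE//; apply: ereal_sup_ubound; exists f => //= t.
have := fg t; rewrite /patch; case: ifPn => [/set_mem [Dt Nt]|].
  by rewrite mem_set// kg.
move=> _ ft; apply: le_trans ft _; case: ifPn => // /set_mem; exact: k0.
Qed.

End bounded_integrals.

(** * Bochner integrals tested against vectors *)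

Section bochner.
Context d (X : measurableType d) (R : realType) (mu : {measure set X -> \bar R}).
Context (D : set X) (mD : measurable D) (finD : (mu D < +oo)%E).
Context (H : completeNormedModType R) (dot : {dot H for idfun}).
Hypothesis hdot : induces_norm dot.
Implicit Types (s g : X -> H).

Lemma finite_set_bounded (V : normedModType R) (A : set V) :
  finite_set A -> exists M, forall y, A y -> `|y| <= M.
Proof.
move=> fA; exists (\sum_(y <- fset_set A) `|y|) => y Ay.
rewrite (bigD1_seq y) ?fset_uniq//=; last by rewrite in_fset_set ?mem_set.
by rewrite lerDl sumr_ge0.
Qed.

Lemma finite_valued_bounded s : finite_valued s -> exists M, forall t, `|s t| <= M.
Proof.
by move=> [/finite_set_bounded[M sM] _]; exists M => t; apply: sM; exists t.
Qed.

Lemma integrable_finite_valued (k : H -> R) s :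
  finite_valued s -> mu.-integrable D (EFin \o (k \o s)).
Proof.
move=> fs; have fks : finite_valued (fun t => k (s t) : R^o) := finite_valued_comp k fs.
have [M kM] := @finite_set_bounded R^o _ fks.1.
apply: (@bounded_integrable _ _ _ mu D mD finD _ M).
  exact: finite_valued_measurable.
by move=> t; apply: kM; exists t.
Qed.

Lemma integrable_finite_valued2 (k : H -> H -> R) s g :
  finite_valued s -> finite_valued g ->
  mu.-integrable D (EFin \o (fun t => k (s t) (g t))).
Proof.
move=> fs fg.
have fks : finite_valued (fun t => k (s t) (g t)) := finite_valued_comp2 k fs fg.
have [M kM] := @finite_set_bounded R^o _ fks.1.
apply: (@bounded_integrable _ _ _ mu D mD finD _ M).
  exact: finite_valued_measurable.
by move=> t; apply: kM; exists t.
Qed.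

Lemma Rintegral_sum (I : Type) (r : seq I) (p : I -> X -> R) :
  (forall i, mu.-integrable D (EFin \o p i)) ->
  \int[mu]_(t in D) (\sum_(i <- r) p i t) =
  \sum_(i <- r) \int[mu]_(t in D) p i t.
Proof.
move=> ip; elim: r => [|i r IH].
  rewrite big_nil; under eq_Rintegral do rewrite big_nil.
  by rewrite Rintegral_cst// mul0r.
rewrite big_cons -IH -RintegralD//.
  by apply: eq_Rintegral => t _; rewrite big_cons.
have -> : EFin \o (fun t => \sum_(j <- r) p j t) =
    (fun t => \sum_(j <- r) (p j t)%:E)%E.
  by apply/funext => t /=; rewrite sumEFin.
by apply: integrable_sum => // j _; exact: ip.
Qed.

Lemma dot_simple_vintegral s u : finite_valued s ->
  dot (simple_vintegral mu D s) u = \int[mu]_(t in D) dot (s t) u.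
Proof.
move=> fs; rewrite /simple_vintegral fsbig_finite; last exact: fs.1.
rewrite (big_morph (dot ^~ u) (fun x y => dotDl dot x y u) (dot0l dot u)).
have iind y : mu.-integrable D (EFin \o \1_(s @^-1` [set y])).
  apply: (@bounded_integrable _ _ _ mu D mD finD _ 1).
    by apply: measurable_indic; exact: fs.2.
  by move=> t; rewrite indicE; case: (_ \in _); rewrite ?normr1 ?normr0.
transitivity (\int[mu]_(t in D)
    (\sum_(y <- fset_set (range s)) dot y u * \1_(s @^-1` [set y]) t)).
  rewrite Rintegral_sum => [|y].
    apply: eq_bigr => y _; rewrite dotZl RintegralZl// mulrC; congr (_ * _).
    by rewrite /Rintegral integral_indic 1?setIC//; exact: fs.2.
  exact: (integrableZl mD (dot y u) (iind y)).
apply: eq_Rintegral => t _.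
rewrite (bigD1_seq (s t)) ?fset_uniq//=; last first.
  by rewrite in_fset_set ?mem_set//; exact: fs.1.
rewrite indicE mem_set// mulr1 big1 ?addr0// => y yt.
rewrite indicE memNset ?mulr0// => /= e; by rewrite e eqxx in yt.
Qed.

(** Duality: tested against [u], both integrals become scalar, so additivity and monotonicity are
    borrowed from the real integral and [le_norm_dot] recovers the norm. *)
Lemma norm_simple_vintegralB s g : finite_valued s -> finite_valued g ->
  `|simple_vintegral mu D s - simple_vintegral mu D g| <=
  \int[mu]_(t in D) `|s t - g t|.
Proof.
move=> fs fg; apply: (le_norm_dot hdot); first exact: Rintegral_ge0.
move=> u; rewrite dotBl !dot_simple_vintegral//.
have id (h : X -> H) : finite_valued h -> mu.-integrable D (EFin \o (fun t => dot (h t) u)).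
  exact: (integrable_finite_valued (dot ^~ u)).
rewrite -RintegralB; [|by []|exact: id|exact: id].
rewrite -RintegralZr//; last exact: (integrable_finite_valued2 (fun x y => `|x - y|)).
apply: le_Rintegral => //.
- exact: (integrable_finite_valued2 (fun x y => dot x u - dot y u)).
- exact: (integrable_finite_valued2 (fun x y => `|x - y| * `|u|)).
- by move=> t Dt; rewrite -dotBl; exact: dot_le.
Qed.

Lemma bounded_simple_approx (f : X -> H) M : 0 <= M -> strongly_measurable mu D f ->
  {ae mu, forall t, D t -> `|f t| <= M} ->
  exists s : nat -> X -> H, exists f' : X -> H,
  [/\ forall n, finite_valued (s n), forall n t, `|s n t| <= M + 1,
     forall t, s n t @[n --> \oo] --> f' t,
     forall t, `|f' t| <= M & {ae mu, forall t, D t -> f t = f' t}].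
Proof.
move=> M0 [s fs [N1 [mN1 N10 sN1]]] [N2 [mN2 N20 sN2]].
pose N := N1 `|` N2.
have mN : measurable N by exact: measurableU.
have N0 : mu N = 0 by exact: null_set_setU.
have nN t : D t -> ~ N t -> `|f t| <= M /\ s n t @[n --> \oo] --> f t.
  move=> Dt Nt; split.
    by apply: contrapT => h; apply: Nt; right; apply: sN2 => /= /(_ Dt).
  by apply: contrapT => h; apply: Nt; left; apply: sN1 => /= /(_ Dt).
(* Truncating at [M + 1] instead of [M] leaves a margin: at each good [t] the bound [M] on the limit
   makes the truncation eventually inactive. Off the good set everything is 0, so that convergence
   holds everywhere. *)
exists (fun n t => if t \in D `\` N then (if `|s n t| <= M + 1 then s n t else 0) else 0).
exists (fun t => if t \in D `\` N then f t else 0); split.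
- move=> n; apply: finite_valued_if; first exact: measurableD.
    exact: (finite_valued_comp (fun x : H => if `|x| <= M + 1 then x else 0) (fs n)).
  exact: finite_valued_cst.
- move=> n t; case: ifP => _; last by rewrite normr0 addr_ge0.
  by case: ifPn => //; rewrite normr0 addr_ge0.
- move=> t; case: ifPn => [/set_mem[Dt Nt]|_]; last exact: cvg_cst.
  have [fM sf] := nN _ Dt Nt.
  apply: (cvg_trans _ sf); apply: near_eq_cvg.
  have /cvgrPdist_lt/(_ _ ltr01) := sf; apply: filterS => n h.
  rewrite ifT//; apply: le_trans (_ : `|f t| + `|f t - s n t| <= _).
    by rewrite -[X in `|X| <= _](subKr (f t)); exact: ler_normB.
  by rewrite lerD// ltW.
- by move=> t; case: ifPn => [/set_mem[Dt Nt]|_]; [exact: (nN _ Dt Nt).1|rewrite normr0].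
- exists N; split => // t /= h; apply: contrapT => Nt; apply: h => Dt.
  by rewrite mem_set.
Qed.

End bochner.

Lemma uniform_cvgP (R : realType) (U : choiceType) (V : normedModType R) (A : set U)
    (u : nat -> U -> V) (l : U -> V) :
  {uniform A, u @ \oo --> l} <->
  forall e, 0 < e -> \forall n \near \oo, forall t, A t -> `|l t - u n t| < e.
Proof.
split=> [ul e e0|h P /uniform_nbhs[E [entE EP]]].
  apply: (ul [set k | forall t, A t -> `|l t - k t| < e]).
  apply/uniform_nbhs; exists [set xy | ball xy.1 e xy.2]; split.
    exact: (@entourage_ball R V (PosNum e0)).
  by move=> k hk t At; have := hk t At; rewrite -ball_normE.
have [e /= e0 eE] : exists2 e : R, 0 < e & [set xy : V * V | ball xy.1 e xy.2] `<=` E.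
  by move: entE; rewrite -entourage_ballE => -[e e0 eE]; exists e.
apply: filterS (h _ e0) => n hn; apply: EP => t At; apply: eE => /=.
by rewrite -ball_normE; exact: hn.
Qed.

Lemma cauchy_seq_cvg (R : realType) (V : completeNormedModType R) (u : nat -> V) :
  (forall e, 0 < e -> exists N, forall n, (N <= n)%N -> `|u N - u n| < e) ->
  exists l : V, u n @[n --> \oo] --> l.
Proof.
move=> uC; suff: cvg (u n @[n --> \oo]) by exists (lim (u n @[n --> \oo])).
apply: cauchy_cvg; apply: cauchy_exP => e e0.
have [N hN] := uC _ e0; exists (u N), N => // n /= Nn.
by rewrite -ball_normE; exact: hN.
Qed.

Section bochner_approx.
Context d (X : measurableType d) (R : realType) (mu : {measure set X -> \bar R}).
Context (D : set X) (mD : measurable D) (finD : (mu D < +oo)%E).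
Context (H : completeNormedModType R) (dot : {dot H for idfun}).
Hypothesis hdot : induces_norm dot.

(** A single finite-valued function has to serve three purposes: a uniform bound, closeness to [f]
    off a small set, and closeness of the integrals. It is a late term of a truncated approximating
    sequence, Egorov's theorem giving the second property and dominated convergence the third. *)
Lemma bochner_approx (f : X -> H) M e : 0 <= M -> strongly_measurable mu D f ->
  {ae mu, forall t, D t -> `|f t| <= M} -> 0 < e ->
  exists s, [/\ finite_valued s, forall t, `|s t| <= M + 1,
    exists2 E, measurable E /\ (mu E <= e%:E)%E &
      forall t, D t -> ~ E t -> `|f t - s t| <= e &
    forall u, `|dot (bochner_integral mu D f) u - \int[mu]_(t in D) dot (s t) u|
      <= e * `|u|].
Proof.
move=> M0 smf fM e0.
have [s [f' [fs sM sf' f'M [N [mN N0 ff'N]]]]] := bounded_simple_approx mD M0 smf fM.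
have ff' : {ae mu, forall t, D t -> f t = f' t} by exists N.
have lf' : simple_limit f' by exists s.
pose q (g : X -> H) t := `|g t - f' t|.
have mq g : finite_valued g -> measurable_fun setT (q g).
  by move=> fg; apply: simple_limit_norm; apply: simple_limitB => //; exact: simple_limit_finite.
have q_bd g : finite_valued g -> exists M', forall t, `|q g t| <= M'.
  move=> /finite_valued_bounded [M' gM']; exists (M' + M) => t.
  by rewrite normr_id; apply: le_trans (ler_normB _ _) _; exact: lerD.
have iq g : finite_valued g -> mu.-integrable D (EFin \o q g).
  by move=> fg; have [M' gM'] := q_bd g fg; exact: (bounded_integrable mD finD (mq _ fg) gM').
have qs_cvg t : D t -> q (s n) t @[n --> \oo] --> (cst 0 : X -> R) t.
  move=> _; rewrite /q /cst -[X in _ --> X](@normr0 _ H) -(subrr (f' t)).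
  by apply: cvg_norm; apply: cvgB => //; exact: cvg_cst.
have qs0 : \int[mu]_(t in D) q (s n) t @[n --> \oo] --> 0.
  rewrite -[X in _ --> X](_ : \int[mu]_(t in D) (cst 0 t) = 0); last first.
    by rewrite Rintegral_cst// mul0r.
  apply: (@bounded_Rintegral_cvg _ _ _ _ _ mD finD _ _ (M + 1 + M)) => //.
  - by move=> n; exact: mq.
  - by move=> n t; rewrite normr_id; apply: le_trans (ler_normB _ _) _; exact: lerD.
  - by apply: aeW => t; exact: qs_cvg.
have qE g : finite_valued g ->
    (\int[mu]_(t in D) `|g t - f t|%:E = (\int[mu]_(t in D) q g t)%:E)%E.
  move=> fg; rewrite EFin_Rintegral//; last exact: iq.
  apply: ge0_ae_eq_integral_ge0 => //.
  - by move=> t _; rewrite lee_fin normr_ge0.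
  - by apply/measurable_EFinP; apply: measurable_funTS; exact: mq.
  - by apply: filterS ff' => t h Dt; rewrite /q h.
have Iq g n : finite_valued g ->
    `|simple_vintegral mu D g - simple_vintegral mu D (s n)| <=
    \int[mu]_(t in D) q g t + \int[mu]_(t in D) q (s n) t.
  move=> fg; apply: le_trans (norm_simple_vintegralB mD finD hdot fg (fs n)) _.
  rewrite -RintegralD//; [|exact: iq|exact: iq].
  apply: le_Rintegral => //.
  - exact: (integrable_finite_valued2 mD finD (fun x y : H => `|x - y|)).
  - have -> : EFin \o (fun t => q g t + q (s n) t) = ((EFin \o q g) \+ (EFin \o q (s n)))%E by [].
    by apply: integrableD => //; exact: iq.
  - by move=> t Dt; rewrite /q (distrC (s n t)); exact: ler_distD.
(* The integrals of the approximants are Cauchy; their limit inhabits [has_bochner_integral], so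
   [bochner_integral] is a genuine integral and not the default 0. *)
have [v sv] : exists v : H, simple_vintegral mu D (s n) @[n --> \oo] --> v.
  apply: cauchy_seq_cvg => r r0.
  have r2 : 0 < r / 2 by rewrite divr_gt0.
  have /cvgrPdist_lt/(_ _ r2)[n0 _ hn] := qs0.
  have {}hn n : (n0 <= n)%N -> \int[mu]_(t in D) q (s n) t < r / 2.
    by move=> /hn; rewrite sub0r normrN => /(le_lt_trans (ler_norm _)).
  exists n0 => n n0n; apply: le_lt_trans (Iq _ n (fs n0)) _.
  by rewrite [ltRHS]splitr ltrD// hn.
have Bv : has_bochner_integral mu D f v.
  split => //; exists s; split => //.
    move=> n; split; first exact: fs.
    move=> y _; apply: le_lt_trans finD; apply: le_measure.
    - by rewrite ?inE; apply: measurableI => //; exact: (fs n).2.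
    - by rewrite ?inE.
    - exact: subIsetl.
  under eq_fun do rewrite qE//.
  suff : (\int[mu]_(t in D) q (s n) t)%:E @[n --> \oo] --> (0 : R)%:E by [].
  by apply: cvg_EFin; [exact: nearW|exact: qs0].
(* The integral picked by [xget] comes with its own approximants [r], unrelated to [s]; [Iq]
   compares the two families through their distances to [f']. *)
have : has_bochner_integral mu D f (bochner_integral mu D f).
  by rewrite /bochner_integral; case: xgetP => [w _ //|/(_ v)].
set v0 := bochner_integral mu D f => -[_ [r [ir rf rv]]].
have fr j : finite_valued (r j) by case: (ir j).
have qr0 : \int[mu]_(t in D) q (r n) t @[n --> \oo] --> 0.
  have : (\int[mu]_(t in D) `|r n t - f t|%:E)%E @[n --> \oo] --> (0 : R)%:E by exact: rf.
  under eq_fun do rewrite qE//.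
  exact: (@fine_cvg _ _ _ _ (fun n => (\int[mu]_(t in D) q (r n) t)%:E)).
have v0s n : `|v0 - simple_vintegral mu D (s n)| <= \int[mu]_(t in D) q (s n) t.
  have h : `|simple_vintegral mu D (r j) - simple_vintegral mu D (s n)|
      - \int[mu]_(t in D) q (r j) t @[j --> \oo] -->
      `|v0 - simple_vintegral mu D (s n)| - 0.
    by apply: cvgB => //; apply: cvg_norm; apply: cvgB => //; exact: cvg_cst.
  rewrite subr0 in h.
  by apply: (cvgr_to_le h); apply: nearW => j; rewrite /= lerBlDl; exact: Iq.
have [B [mB Be /uniform_cvgP/(_ _ e0)[n1 _ BU]]] := @pointwise_almost_uniform _ R _ mu
  (fun n => q (s n)) (cst 0) D e (fun n => measurable_funTS (mq _ (fs n))) mD finD qs_cvg e0.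
have /cvgrPdist_lt/(_ _ e0)[n2 _ qsn] := qs0.
pose n := maxn n1 n2.
exists (s n); split; [exact: fs|exact: sM| |].
  exists (B `|` N) => [|t Dt /not_orP[Bt Nt]]; first by
    split; [exact: measurableU|rewrite measureU0//; exact: ltW].
  have -> : f t = f' t by apply: contrapT => h; apply: Nt; apply: ff'N => /= /(_ Dt).
  have /= := BU n (leq_maxl _ _) t (conj Dt Bt).
  by rewrite sub0r normrN normr_id distrC => /ltW.
move=> u; rewrite -dot_simple_vintegral// -dotBl.
apply: le_trans (cauchy_schwarz hdot _ _) _; rewrite ler_wpM2r//.
apply: le_trans (v0s n) _; have /= := qsn n (leq_maxr _ _).
by rewrite sub0r normrN => /ltW; apply: le_trans; exact: ler_norm.
Qed.

End bochner_approx.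

(** * Strong limits in midpoint hulls *)

Section midpoint_hull.
Context (R : realType) (E : lmodType R).

(** Dyadic convex combinations of the tail from [n]. Midpoints are all that the parallelogram
    identity uses, and any property stable under midpoints passes to the hull by induction. *)
Inductive midpoint_hull (p : nat -> E) (n : nat) : E -> Prop :=
| midpoint_hull_base m : (n <= m)%N -> midpoint_hull p n (p m)
| midpoint_hull_mid a b : midpoint_hull p n a -> midpoint_hull p n b ->
    midpoint_hull p n (2^-1 *: (a + b)).

Lemma midpoint_hull_antitone p m n a :
  (m <= n)%N -> midpoint_hull p n a -> midpoint_hull p m a.
Proof.
move=> mn; elim=> [k nk|b c _ IHb _ IHc].
  by apply: midpoint_hull_base; exact: leq_trans nk.
exact: midpoint_hull_mid.
Qed.

(** The classical argument for the projection onto a convex set, for a decreasing family: if the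
    midpoint of two near minimisers has [N] at least [d - r i], the identity bounds [N] of the
    difference by [2 (d + r i) + 2 (d + r j) - 4 (d - r i)], hence by [8 r i]. It serves both for
    the hulls in L^2 and for separation in [H]. *)
Lemma near_minimizers_cauchy (K : nat -> set E) (N : E -> R) (M : R) (r : nat -> R) :
  (forall a, 0 <= N a) ->
  (forall m n, (m <= n)%N -> K n `<=` K m) ->
  (forall n a b, K n a -> K n b -> K n (2^-1 *: (a + b))) ->
  (forall a b, K 0%N a -> K 0%N b ->
    N (a - b) = 2 * N a + 2 * N b - 4 * N (2^-1 *: (a + b))) ->
  (forall n, exists2 a, K n a & N a <= M) ->
  (forall n, 0 < r n) -> (forall m n, (m <= n)%N -> r n <= r m) ->
  exists d G, [/\ forall j, K j (G j), forall j, N (G j) <= d + r j,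
    forall e, 0 < e -> exists n, forall a, K n a -> d - e <= N a &
    forall i j, (i <= j)%N -> N (G i - G j) <= 8 * r i].
Proof.
move=> N0 Kanti Kmid Npar KM r0 rmono.
pose A : set R := [set c | exists n, forall a, K n a -> c <= N a].
have A0 : A 0 by exists 0%N.
have ubA : has_ubound A.
  exists M => c [n cN]; have [a Ka aM] := KM n; exact: le_trans (cN _ Ka) aM.
(* [A] collects the eventual lower bounds of [N], so [d] is the limit of the nondecreasing infima of
   [N] over [K n]. *)
pose d := sup A.
have dlow e : 0 < e -> exists n, forall a, K n a -> d - e <= N a.
  move=> e0; have [c [n cN] dc] := sup_adherent e0 (conj (ex_intro _ 0 A0) ubA).
  by exists n => a Ka; apply: le_trans (cN _ Ka); exact: ltW.
have dup n e : 0 < e -> exists2 a, K n a & N a <= d + e.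
  move=> e0; apply: contrapT => h.
  have : A (d + e).
    exists n => a Ka; rewrite leNgt; apply/negP => aN; apply: h; exists a => //.
    exact: ltW.
  by move=> /(ub_le_sup ubA); rewrite -/d gerDl leNgt e0.
have nk j : {n | forall a, K n a -> d - r j <= N a} := cid (dlow _ (r0 j)).
have G j : {a | K (maxn j (sval (nk j))) a /\ N a <= d + r j}.
  by apply: cid; have [a Ka aN] := dup (maxn j (sval (nk j))) _ (r0 j); exists a.
exists d, (fun j => sval (G j)); split => //.
- by move=> j; apply: (Kanti _ _ (leq_maxl j (sval (nk j)))); exact: (svalP (G j)).1.
- by move=> j; exact: (svalP (G j)).2.
move=> i j ij.
have [Gi Ni] := svalP (G i); have [Gj Nj] := svalP (G j).
have low : d - r i <= N (2^-1 *: (sval (G i) + sval (G j))).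
  (* The thresholds [nk] need not be monotone, so the midpoint is placed in the [K] of the smaller
     one. *)
  have [le|le] := leqP (sval (nk i)) (sval (nk j)).
    apply: (svalP (nk i)); apply: Kmid.
      exact: Kanti (leq_maxr _ _) _ Gi.
    by apply: Kanti Gj; rewrite (leq_trans le)// leq_maxr.
  apply: le_trans (_ : d - r j <= _); first by rewrite lerD2l lerN2 rmono.
  apply: (svalP (nk j)); apply: Kmid; last exact: Kanti (leq_maxr _ _) _ Gj.
  by apply: Kanti Gi; rewrite (leq_trans (ltnW le))// leq_maxr.
rewrite Npar; [|exact: Kanti (leq0n _) _ Gi|exact: Kanti (leq0n _) _ Gj].
have := rmono _ _ ij; lra.
Qed.

End midpoint_hull.

Definition dyadic (R : realType) n : R := 1 / (2 ^ n.+1)%:R.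

(** * Dyadic errors: geometric Cauchy criterion and the Borel-Cantelli lemma *)

Section dyadic.
Context (R : realType).
Local Notation dyadic := (dyadic R).

Lemma dyadic_gt0 n : 0 < dyadic n.
Proof. by rewrite divr_gt0// ltr0n expn_gt0. Qed.

Lemma dyadicS n : dyadic n = 2 * dyadic n.+1.
Proof. by rewrite /dyadic !natrX [in RHS]exprS; field; rewrite expf_neq0 ?pnatr_eq0. Qed.

Lemma dyadic_antitone m n : (m <= n)%N -> dyadic n <= dyadic m.
Proof.
move=> mn; rewrite /dyadic ler_pdivrMr ?ltr0n ?expn_gt0// mulrAC mul1r.
by rewrite ler_pdivlMr ?ltr0n ?expn_gt0// mul1r ler_nat leq_exp2l.
Qed.

Lemma dyadic_le n : dyadic n <= n.+1%:R^-1.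
Proof. by rewrite /dyadic div1r lef_pV2 ?posrE ?ltr0n ?expn_gt0// ler_nat ltnW// ltn_expl. Qed.

Lemma cvg_dyadic : dyadic n @[n --> \oo] --> 0.
Proof.
apply: (@squeeze_cvgr _ _ _ _ (fun=> 0) (fun n => n.+1%:R^-1)).
- by apply: nearW => n; rewrite dyadic_le (ltW (dyadic_gt0 _)).
- exact: cvg_cst.
- exact: cvg_harmonic.
Qed.

Lemma cauchy_dyadic_cvg (V : completeNormedModType R) (u : nat -> V) N :
  (forall n, (N <= n)%N -> `|u n - u n.+1| <= dyadic n) ->
  exists l : V, u n @[n --> \oo] --> l.
Proof.
move=> uN.
(* The right-hand side is the exact sum of the terms [dyadic k] for [n <= k < n + m]. *)
have tel n m : (N <= n)%N -> `|u n - u (n + m)%N| <= 2 * dyadic n - 2 * dyadic (n + m)%N.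
  move=> Nn; elim: m => [|m IH]; first by rewrite addn0 !subrr normr0.
  apply: le_trans (ler_distD (u (n + m)%N) _ _) _.
  rewrite addnS; have := uN (n + m)%N (leq_trans Nn (leq_addr _ _)).
  have := dyadicS (n + m); move: IH; lra.
apply: cauchy_seq_cvg => e e0.
have e2 : 0 < e / 2 by rewrite divr_gt0.
have /cvgrPdist_lt/(_ _ e2)[n0 _ hn0] := cvg_dyadic.
exists (maxn N n0) => n /subnKC <-.
apply: le_lt_trans (tel _ _ (leq_maxl _ _)) _.
have := hn0 (maxn N n0) (leq_maxr _ _); rewrite /= sub0r normrN => /(le_lt_trans (ler_norm _)).
have := dyadic_gt0 (maxn N n0 + (n - maxn N n0)); lra.
Qed.

Lemma borel_cantelli_dyadic d (X : measurableType d) (mu : {measure set X -> \bar R})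
    (A : nat -> set X) : (forall n, measurable (A n)) ->
  (forall n, mu (A n) <= (dyadic n)%:E)%E ->
  {ae mu, forall t, exists N, forall n, (N <= n)%N -> ~ A n t}.
Proof.
move=> mA muA.
have h : mu (lim_sup_set A) = 0.
  apply: lim_sup_set_cvg0 => //.
  apply: (@le_lt_trans _ _ 1%:E); last exact: ltry.
  apply: le_trans (epsilon_trick0 xpredT (ler01 : (0 : R) <= 1)).
  by apply: lee_nneseries => n _ //; exact: muA.
exists (lim_sup_set A); split => //.
  by apply: bigcap_measurable => // k _; exact: bigcup_measurable.
move=> t /= /forallNP ht n _; have /existsNP[m /not_implyP[nm /contrapT Am]] := ht n.
by exists m.
Qed.

End dyadic.

(** * Almost everywhere convergence of hull elements *)

Section midpoint_hull_cvg.
Context d (X : measurableType d) (R : realType) (mu : {measure set X -> \bar R}).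
Context (D : set X) (mD : measurable D) (finD : (mu D < +oo)%E).
Context (H : completeNormedModType R) (dot : {dot H for idfun}).
Hypothesis hdot : induces_norm dot.
Local Notation E := ((X -> H) * (X -> H))%type.

Lemma markov_sqr_norm (a : E) c : finite_valued a.1 -> finite_valued a.2 -> 0 < c ->
  let A := D `&` [set t | ~ (`|a.1 t| <= c /\ `|a.2 t| <= c)] in
  measurable A /\ (mu A <= ((\int[mu]_(t in D) (`|a.1 t| ^+ 2 + `|a.2 t| ^+ 2)) / c ^+ 2)%:E)%E.
Proof.
move=> f1 f2 c0 A.
have mA : measurable A.
  apply: measurableI => //.
  exact: (finite_valued_preimage [set p | ~ (`|p.1| <= c /\ `|p.2| <= c)]
    (finite_valued_pair f1 f2)).
split=> //.
have finA : (mu A < +oo)%E.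
  apply: le_lt_trans finD; apply: le_measure; rewrite ?inE//; exact: subIsetl.
rewrite -[leLHS]fineK ?ge0_fin_numE// lee_fin ler_pdivlMr ?exprn_gt0//.
have mI : measurable_fun setT (\1_A : X -> R) by exact: measurable_indic.
have iI : mu.-integrable D (EFin \o (\1_A : X -> R)).
  apply: (bounded_integrable mD finD (M := 1)) => // t.
  by rewrite indicE; case: (_ \in _); rewrite ?normr1 ?normr0.
have -> : fine (mu A) = \int[mu]_(t in D) \1_A t.
  rewrite /Rintegral integral_indic//; congr (fine (mu _)).
  by rewrite /A setIAC setIid.
rewrite mulrC -RintegralZl//; apply: le_Rintegral => //.
- exact: (integrableZl mD (c ^+ 2) iI).
- exact: (integrable_finite_valued2 mD finD (fun x y : H => `|x| ^+ 2 + `|y| ^+ 2)).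
- move=> t Dt; rewrite indicE; have [At|At] := pselect (A t); last first.
    by rewrite memNset// mulr0 addr_ge0.
  rewrite mem_set// mulr1; case: At => _ /=.
  have [a1|a1] := lerP `|a.1 t| c; last first.
    move=> _; apply: ler_wpDr => //.
    by rewrite ler_sqr ?nnegrE ?ltW// (lt_trans c0).
  move=> /not_andP[//|/negP]; rewrite -ltNge => a2; apply: ler_wpDl => //.
  by rewrite ler_sqr ?nnegrE ?ltW// (lt_trans c0).
Qed.

Variables (Phi : nat -> E) (M : R).
Hypothesis fPhi : forall n, finite_valued (Phi n).1 /\ finite_valued (Phi n).2.
Hypothesis PhiM : forall n t, `|(Phi n).1 t| <= M /\ `|(Phi n).2 t| <= M.

Lemma midpoint_hull_finite n a : midpoint_hull Phi n a ->
  finite_valued a.1 /\ finite_valued a.2.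
Proof.
elim=> [m _|b c _ [fb1 fb2] _ [fc1 fc2]]; first exact: fPhi.
by split; exact: (finite_valued_comp2 (fun x y : H => 2^-1 *: (x + y))).
Qed.

Lemma norm_midpoint (x y : H) : `|x| <= M -> `|y| <= M -> `|2^-1 *: (x + y)| <= M.
Proof.
move=> xM yM; rewrite normrZ normfV ger0_norm// ler_pdivrMl//.
by apply: le_trans (ler_normD _ _) _; lra.
Qed.

Lemma midpoint_hull_bound n a : midpoint_hull Phi n a ->
  forall t, `|a.1 t| <= M /\ `|a.2 t| <= M.
Proof.
elim=> [m _|b c _ IHb _ IHc] t; first exact: PhiM.
by have [b1 b2] := IHb t; have [c1 c2] := IHc t; split; exact: norm_midpoint.
Qed.

(** The squared norm of L^2(D; H x H): the pair is one vector, so the same midpoints act on both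
    components. *)
Let N (a : E) := \int[mu]_(t in D) (`|a.1 t| ^+ 2 + `|a.2 t| ^+ 2).

Let iN (a : E) : finite_valued a.1 -> finite_valued a.2 ->
  mu.-integrable D (EFin \o (fun t => `|a.1 t| ^+ 2 + `|a.2 t| ^+ 2)).
Proof. exact: (integrable_finite_valued2 mD finD (fun x y : H => `|x| ^+ 2 + `|y| ^+ 2)). Qed.

Let N_parallelogram (a b : E) : finite_valued a.1 -> finite_valued a.2 ->
  finite_valued b.1 -> finite_valued b.2 ->
  N (a - b) = 2 * N a + 2 * N b - 4 * N (2^-1 *: (a + b)).
Proof.
move=> fa1 fa2 fb1 fb2.
have iab : mu.-integrable D (EFin \o (fun t =>
    `|(2^-1 *: (a + b)).1 t| ^+ 2 + `|(2^-1 *: (a + b)).2 t| ^+ 2)).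
  by apply: iN; exact: (finite_valued_comp2 (fun x y : H => 2^-1 *: (x + y))).
have iZ (c : R) (p : X -> R) : mu.-integrable D (EFin \o p) ->
    mu.-integrable D (EFin \o (fun t => c * p t)) := fun ip => integrableZl mD c ip.
rewrite /N -!RintegralZl//; [|exact: iN|exact: iN].
rewrite -RintegralD//; [|by apply: iZ; exact: iN|by apply: iZ; exact: iN].
rewrite -RintegralB//; last by apply: iZ.
  apply: eq_Rintegral => t _ /=.
  have h (x y : H) : `|x - y| ^+ 2 =
      2 * `|x| ^+ 2 + 2 * `|y| ^+ 2 - 4 * `|2^-1 *: (x + y)| ^+ 2.
    have := parallelogram hdot x y; rewrite normrZ exprMn normfV (ger0_norm (ler0n _ 2)).
    by move=> <-; field.
  rewrite (h (a.1 t) (b.1 t)) (h (a.2 t) (b.2 t)); ring.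
have i1 := iZ 2 _ (iN fa1 fa2); have i2 := iZ 2 _ (iN fb1 fb2).
exact: (integrableD mD i1 i2).
Qed.

Lemma midpoint_hull_cvg : exists G : nat -> E, exists g1 g2 : X -> H,
  [/\ forall j, midpoint_hull Phi j (G j), simple_limit g1 /\ simple_limit g2,
    forall t, `|g1 t| <= M /\ `|g2 t| <= M &
    {ae mu, forall t, D t -> (G j).1 t @[j --> \oo] --> g1 t /\
                            (G j).2 t @[j --> \oo] --> g2 t}].
Proof.
(* The cube makes both requirements summable: [8 r j] divided by [dyadic j ^+ 2] is the Markov bound
   [dyadic j] on the set where an increment exceeds [dyadic j]. Borel-Cantelli removes these sets,
   and the remaining increments form a convergent series. *)
pose r j : R := dyadic R j ^+ 3 / 8.
have r0 j : 0 < r j by rewrite divr_gt0// exprn_gt0// dyadic_gt0.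
have rmono m n : (m <= n)%N -> r n <= r m.
  move=> mn; rewrite ler_pM2r ?invr_gt0//.
  by rewrite lerXn2r ?nnegrE ?(ltW (dyadic_gt0 _ _))// dyadic_antitone.
have [dd [G [KG _ _ GG]]] : exists d G, [/\ forall j, midpoint_hull Phi j (G j),
    forall j, N (G j) <= d + r j,
    forall e, 0 < e -> exists n, forall a, midpoint_hull Phi n a -> d - e <= N a &
    forall i j, (i <= j)%N -> N (G i - G j) <= 8 * r i].
  apply: (@near_minimizers_cauchy _ _ (midpoint_hull Phi) N (2 * M ^+ 2 * fine (mu D))) => //.
  - by move=> a; apply: Rintegral_ge0 => t _; rewrite addr_ge0.
  - by move=> m n mn a; exact: midpoint_hull_antitone.
  - by move=> n a b; exact: midpoint_hull_mid.
  - move=> a b /midpoint_hull_finite[fa1 fa2] /midpoint_hull_finite[fb1 fb2].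
    exact: N_parallelogram.
  - move=> n; exists (Phi n); first exact: midpoint_hull_base.
    have [f1 f2] := fPhi n.
    apply: le_Rintegral_bound => //; first exact: iN.
    move=> t _; have [h1 h2] := PhiM n t.
    have M0 : 0 <= M by exact: le_trans h1.
    by rewrite [leRHS]mulr_natl mulr2n lerD// ler_sqr ?nnegrE.
pose A j := D `&` [set t | ~ (`|(G j - G j.+1).1 t| <= dyadic R j /\
                              `|(G j - G j.+1).2 t| <= dyadic R j)].
have fG j := midpoint_hull_finite (KG j).
have hA j : measurable (A j) /\ (mu (A j) <= (dyadic R j)%:E)%E.
  have [fG1 fG2] := fG j; have [fG3 fG4] := fG j.+1.
  have [mA muA] := @markov_sqr_norm (G j - G j.+1) (dyadic R j)
    (finite_valued_comp2 (fun x y : H => x - y) fG1 fG3)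
    (finite_valued_comp2 (fun x y : H => x - y) fG2 fG4) (dyadic_gt0 R j).
  split=> //; apply: le_trans muA _; rewrite lee_fin ler_pdivrMr ?exprn_gt0 ?dyadic_gt0//.
  apply: le_trans (GG _ _ (leqnSn j)) _; rewrite /r -exprS; lra.
have [Z [mZ Z0 AZ]] := borel_cantelli_dyadic (fun j => (hA j).1) (fun j => (hA j).2).
have GZ t : D t -> ~ Z t -> (exists l : H, (G j).1 t @[j --> \oo] --> l) /\
    (exists l : H, (G j).2 t @[j --> \oo] --> l).
  move=> Dt Zt.
  have [n0 hn0] : exists N, forall n, (N <= n)%N -> ~ A n t.
    by apply: contrapT => h; apply: Zt; exact: AZ.
  have {}hn0 n : (n0 <= n)%N -> `|(G n - G n.+1).1 t| <= dyadic R n /\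
                              `|(G n - G n.+1).2 t| <= dyadic R n.
    by move=> /hn0 h; apply: contrapT => h'; apply: h.
  by split; apply: (@cauchy_dyadic_cvg _ _ _ n0) => n /hn0[].
have M0 (t : X) : 0 <= M by have [h _] := PhiM 0 t; exact: le_trans h.
pose g (s : E -> X -> H) t : H :=
  if t \in D `\` Z then lim ((fun j => s (G j) t) @ \oo) else 0.
have mDZ : measurable (D `\` Z) by exact: measurableD.
have gcvg (s : E -> X -> H) : (forall j, finite_valued (s (G j))) ->
    (forall j t, `|s (G j) t| <= M) ->
    (forall t, D t -> ~ Z t -> exists l : H, s (G j) t @[j --> \oo] --> l) ->
    [/\ simple_limit (g s), forall t, `|g s t| <= M &
     forall t, D t -> ~ Z t -> s (G j) t @[j --> \oo] --> g s t].
  move=> fs sM sl.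
  have cv t : D t -> ~ Z t -> s (G j) t @[j --> \oo] --> g s t.
    move=> Dt Zt; rewrite /g mem_set//; apply/cvg_ex; exact: sl.
  split => //.
    exists (fun j t => if t \in D `\` Z then s (G j) t else 0).
      by move=> n; apply: finite_valued_if => //; exact: finite_valued_cst.
    move=> t; have [[Dt Zt]|tDZ] := pselect ((D `\` Z) t).
      by rewrite mem_set//; exact: cv.
    by rewrite /g memNset//; exact: cvg_cst.
  move=> t; have [[Dt Zt]|tDZ] := pselect ((D `\` Z) t); last first.
    by rewrite /g memNset// normr0 (M0 t).
  apply: (cvgr_to_le (cvg_norm (cv t Dt Zt))).
  by apply: nearW => j; exact: sM.
have [sl1 gM1 cv1] := gcvg fst (fun j => (fG j).1)
  (fun j t => (midpoint_hull_bound (KG j) t).1) (fun t Dt Zt => (GZ t Dt Zt).1).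
have [sl2 gM2 cv2] := gcvg snd (fun j => (fG j).2)
  (fun j t => (midpoint_hull_bound (KG j) t).2) (fun t Dt Zt => (GZ t Dt Zt).2).
exists G, (g fst), (g snd); split => //.
exists Z; split => // t /= h; apply: contrapT => Zt; apply: h => Dt.
by split; [exact: cv1|exact: cv2].
Qed.

End midpoint_hull_cvg.

(** * Weakly closed half-spaces, normal cones and projections *)

Section weak_half_space.
Context (R : realType) (H : completeNormedModType R) (dot : {dot H for idfun}).
Hypothesis hdot : induces_norm dot.

(** A name of its own and the codomain [R^o] allow a linear structure to be attached, as
    [topological_dual] requires. *)
Definition dotl (v x : H) : R^o := dot x v.

Lemma dotl_linear v : linear (dotl v).
Proof. by move=> a x y; rewrite /dotl dotDl dotZl. Qed.

HB.instance Definition _ v :=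
  GRing.isLinear.Build R H R^o *:%R (dotl v) (dotl_linear v).

Lemma weakly_closed_half_space (v : H) (c : R) :
  weakly_closed [set w : H | c <= dot w v].
Proof.
pose l : topological_dual H :=
  exist _ (dotl v : {linear H -> R^o}) (@dot_continuous _ _ _ hdot v).
rewrite /weakly_closed -[X in closed X]setCK; apply: open_closedC.
pose Tc := fun l : topological_dual H =>
  Topological.class (initial_topology (sval l : H -> R^o)).
(* A subbasic set is the union of one intersection of one set; the complement of the half-space is
   subbasic for the functional [l]. *)
have sub : sup_subbase Tc `<=` @open (sup_topology Tc).
  move=> A hA; exists [set A]; last by rewrite bigcup_set1.
  move=> _ ->; exists [fset A]%fset.
    by move=> B /fset1P ->; exact/mem_set.
  by rewrite set_fset1 bigcap_set1.
apply: sub; exists l => //.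
exists [set x : R^o | x < c].
  exact: open_lt.
by apply/seteqP; split=> x /=; [rewrite ltNge => /negP|move=> /negP; rewrite -ltNge].
Qed.

End weak_half_space.

Section normals_and_projections.
Context (R : realType) (H : completeNormedModType R) (dot : {dot H for idfun}).
Hypothesis hdot : induces_norm dot.
Implicit Types (S : set H) (x y z w : H).

(** It suffices to test the tangent cone on the constant sequence [x] with steps [harmonic n]: the
    Frechet inequality at [x + harmonic n *: w n], divided by the step, passes to the limit. *)
Lemma frechet_clarke_normal S x xi : S x ->
  (forall e, 0 < e -> exists2 delta, 0 < delta & forall y, S y ->
     `|y - x| <= delta -> dot xi (y - x) <= e * `|y - x|) ->
  clarke_normal_cone dot S x xi.
Proof.
move=> Sx xiF; split => // v Tv.
have [w wv Sw] := Tv (fun=> x) harmonic (fun=> Sx) (cvg_cst x)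
  (fun n => harmonic_gt0 n) cvg_harmonic.
have hw : harmonic n *: w n @[n --> \oo] --> (0 : R) *: v.
  by apply: cvgZ => //; exact: cvg_harmonic.
apply/ler_addgt0Pr => e0 e00; rewrite add0r.
pose e := e0 / (`|v| + 1).
have v1 : 0 < `|v| + 1 by rewrite ltr_wpDl.
have epos : 0 < e by rewrite divr_gt0.
have [delta d0 hd] := xiF _ epos.
have le_e : dot xi v <= e * `|v|.
  have h : dot xi (w n) - e * `|w n| @[n --> \oo] --> dot xi v - e * `|v|.
    apply: cvgB; last by apply: cvgMr; exact: cvg_norm.
    under eq_fun do rewrite dotC; rewrite dotC.
    exact: cvg_dotl.
  rewrite -subr_le0; apply: (cvgr_to_le h).
  move/cvgrPdist_le : hw => /(_ _ d0); apply: filterS => n.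
  rewrite scale0r sub0r normrN => hn; rewrite subr_le0.
  have := hd _ (Sw n); rewrite addrAC subrr add0r => /(_ hn).
  rewrite dotZr normrZ (ger0_norm (ltW (harmonic_gt0 _))) mulrCA.
  by rewrite ler_pM2l// harmonic_gt0.
apply: le_trans le_e _; rewrite /e mulrAC ler_pdivrMr//.
by rewrite ler_pM2l// lerDl.
Qed.

(** Minimality gives [2 dot (y - w) (x - w) <= |x - w|^2], a quadratic bound, so the radius [e]
    itself witnesses the Frechet condition. *)
Lemma projection_clarke_normal S y w : S w ->
  (forall x, S x -> `|y - w| <= `|y - x|) -> clarke_normal_cone dot S w (y - w).
Proof.
move=> Sw wmin; apply: frechet_clarke_normal => // e e0; exists e => // x Sx xe.
have : `|y - w| ^+ 2 <= `|(y - w) - (x - w)| ^+ 2.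
  by rewrite opprB addrA subrK ler_sqr ?nnegrE// wmin.
rewrite [leRHS](sqr_normB hdot) -addrA lerDl addrC subr_ge0 => h.
apply: le_trans (_ : `|x - w| ^+ 2 <= _); last by rewrite expr2 ler_wpM2r.
move: h; have : 0 <= `|x - w| ^+ 2 by [].
have [d0|d0] := leP (dot (y - w) (x - w)) 0; first by move: d0; lra.
by move: d0; lra.
Qed.

Lemma clarke_normalZ S x xi (c : R) : 0 <= c -> clarke_normal_cone dot S x xi ->
  clarke_normal_cone dot S x (c *: xi).
Proof.
move=> c0 [Sx nxi]; split=> // v Tv; rewrite dotZl mulr_ge0_le0//.
exact: nxi.
Qed.

(** Subsmoothness speaks of unit-ball normals; scaling [xi] by the inverse of [M] brings it there,
    at the cost of asking for the modulus of [e / M]. *)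
Lemma subsmooth_normal_le (I : set R) (C : R -> set H) (M e : R) :
  equi_uniformly_subsmooth dot I C -> 0 < M -> 0 < e ->
  exists2 delta, 0 < delta & forall t, I t -> forall x y xi, C t x -> C t y ->
    `|y - x| <= delta -> clarke_normal_cone dot (C t) x xi -> `|xi| <= M ->
    dot xi (y - x) <= e * `|y - x|.
Proof.
move=> sub M0 e0; have [delta d0 h] := sub _ (divr_gt0 e0 M0).
exists delta => // t It x y xi Cx Cy yx nxi xiM.
have n0 : clarke_normal_cone dot (C t) y 0 by split=> // v _; rewrite dot0l.
have nM : clarke_normal_cone dot (C t) x (M^-1 *: xi).
  by apply: clarke_normalZ => //; rewrite invr_ge0 ltW.
have := h t It _ _ _ _ Cy Cx yx n0.
rewrite normr0 => /(_ _ ler01 nM); rewrite normrZ normfV (gtr0_norm M0).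
rewrite ler_pdivrMl// mulr1 => /(_ xiM); rewrite subr0 dotZl.
rewrite -opprB dotNr normrN mulrN mulNr lerN2 ler_pdivrMl//.
by rewrite mulrA (mulrC M) divfK ?gt_eqF.
Qed.

Lemma approx_proj_le (e : R) S y z : approx_proj e S y z ->
  S z /\ forall w, S w -> `|y - z| ^+ 2 < `|y - w| ^+ 2 + e.
Proof.
move=> [Sz zlt]; split=> // w Sw; rewrite -lte_fin; apply: lt_le_trans zlt _.
have : (0 <= dist S y)%E by apply: le_ereal_inf_tmp => _ [x _ <-]; rewrite lee_fin.
have : (dist S y <= `|y - w|%:E)%E by apply: ereal_inf_lbound; exists w.
case: (dist S y) => [r| |] //; rewrite !lee_fin => rw r0.
by rewrite lerD2r -expr2 ler_sqr ?nnegrE.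
Qed.

Lemma exists_projection S x0 y : S x0 -> ball_compact S ->
  exists2 w, S w & forall x, S x -> `|y - w| <= `|y - x|.
Proof.
move=> Sx0 Sbc.
(* Points of norm above [r] are farther from [y] than [x0] is, so minimising over the ball is
   enough. *)
pose r := `|y| + `|y - x0| + 1.
have r0 : 0 < r by rewrite ltr_wpDl.
pose K := S `&` [set x | `|x| <= r].
have [||w /set_mem[Sw _] wmin] := @compact_EVT_min H R (fun x => `|y - x|) K _ (Sbc r r0).
- exists x0; split=> //=; apply: le_trans (_ : `|y| + `|y - x0| <= _).
    by rewrite -[X in `|X| <= _](subKr y); exact: ler_normB.
  by rewrite lerDl.
- apply: continuous_subspaceT => x; apply: cvg_norm; apply: cvgB; first exact: cvg_cst.
  exact: cvg_id.
have K0 : K x0.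
  split=> //=; apply: le_trans (_ : `|y| + `|y - x0| <= _).
    by rewrite -[X in `|X| <= _](subKr y); exact: ler_normB.
  by rewrite lerDl.
exists w => // x Sx; have [xr|xr] := leP `|x| r; first exact/wmin/mem_set.
apply: le_trans (wmin _ (mem_set K0)) _.
have : `|x| <= `|y| + `|y - x|.
  by rewrite -[X in `|X| <= _](subKr y); exact: ler_normB.
by move: xr; rewrite /r; lra.
Qed.

(* The minimiser w of the sum of the squared distances to y and z is a
   projection of the midpoint of y and z. *)
Lemma near_projection_normal S y z e : ball_compact S -> S z ->
  (forall w, S w -> `|y - z| ^+ 2 < `|y - w| ^+ 2 + e) ->
  exists2 w, S w /\ `|z - w| ^+ 2 < e & clarke_normal_cone dot S w ((y - w) + (z - w)).
Proof.
move=> Sbc Sz zlt; pose m := 2^-1 *: (y + z).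
have [w Sw wmin] := exists_projection m Sz Sbc.
exists w.
  (* Apollonius' identity at [w] and at [z], with [m] no farther from [w] than from [z], gives
     [|y - w|^2 + |z - w|^2 <= |y - z|^2]; near minimality of [z] then bounds [|z - w|^2] by [e]. *)
  split=> //; have h1 := sqr_norm_midpoint hdot w y z.
  have h2 := sqr_norm_midpoint hdot z y z; rewrite subrr normr0 expr0n addr0 in h2.
  have h3 := zlt w Sw.
  have : `|m - w| ^+ 2 <= `|m - z| ^+ 2 by rewrite ler_sqr ?nnegrE// wmin.
  by rewrite -/m in h1 h2; lra.
have -> : y - w + (z - w) = 2 *: (m - w).
  by rewrite scalerBr scalerA divff// scale1r addrACA -opprD -mulr2n -scaler_nat.
by apply: clarke_normalZ => //; exact: projection_clarke_normal.
Qed.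

End normals_and_projections.

Section separation.
Context (R : realType) (H : completeNormedModType R) (dot : {dot H for idfun}).
Hypothesis hdot : induces_norm dot.

Lemma convex_set_comb (Q : set H) (a b : H) (k : R) : convex_set Q -> Q a -> Q b ->
  0 <= k -> k <= 1 -> Q (k *: a + (1 - k) *: b).
Proof.
move=> cQ Qa Qb k0 k1.
have := cQ a b (Itv01 k0 k1) (mem_set Qa) (mem_set Qb).
by move=> /set_mem.
Qed.

(** The vector [l] of least norm in [Q - g] exists by completeness, as the limit of near minimisers
    over a constant family. Its variational inequality puts [Q] at level at least [|l|^2] above [g]
    in the direction [l]; the separating direction is [- l] and the level is taken half-way. *)
Lemma strict_separation (Q : set H) (g : H) :
  closed Q -> convex_set Q -> Q !=set0 -> ~ Q g ->
  exists v c, (forall q, Q q -> dot q v < c) /\ c < dot g v.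
Proof.
move=> clQ cQ [q0 Qq0] nQg.
pose K (n : nat) := [set a | Q (a + g)].
have Kcomb a b k : Q (a + g) -> Q (b + g) -> 0 <= k -> k <= 1 ->
    Q ((k *: a + (1 - k) *: b) + g).
  move=> Qa Qb k0 k1; have := convex_set_comb cQ Qa Qb k0 k1.
  rewrite !scalerDr addrACA -scalerDl (_ : k + (1 - k) = 1) ?scale1r//; ring.
pose r n := dyadic R n / 8.
have [d [G [KG NG dlow GG]]] : exists d G, [/\ forall j, K j (G j),
    forall j, `|G j| ^+ 2 <= d + r j,
    forall e, 0 < e -> exists n, forall a, K n a -> d - e <= `|a| ^+ 2 &
    forall i j, (i <= j)%N -> `|G i - G j| ^+ 2 <= 8 * r i].
  apply: (@near_minimizers_cauchy R H K (fun a => `|a| ^+ 2) (`|q0 - g| ^+ 2)) => //.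
  - by move=> m n _ a.
  - move=> n a b Ka Kb; have := Kcomb _ _ 2^-1 Ka Kb.
    rewrite /K /= invr_ge0 ler0n invf_le1// ler1n => /(_ isT isT).
    by rewrite (_ : 1 - 2^-1 = 2^-1 :> R) -?scalerDr//; field.
  - move=> a b _ _; have := parallelogram hdot a b.
    by rewrite normrZ exprMn normfV (ger0_norm (ler0n _ 2)) => <-; field.
  - by move=> n; exists (q0 - g) => //; rewrite /K /= subrK.
  - by move=> n; rewrite divr_gt0// dyadic_gt0.
  - by move=> m n mn; rewrite ler_pM2r ?invr_gt0//; exact: dyadic_antitone.
have [l Gl] : exists l : H, G n @[n --> \oo] --> l.
  apply: cauchy_seq_cvg => e e0.
  have e2 : 0 < e ^+ 2 by rewrite exprn_gt0.
  have /cvgrPdist_lt/(_ _ e2)[n0 _ hn0] := @cvg_dyadic R.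
  exists n0 => n n0n; rewrite -ltr_sqr ?nnegrE ?(ltW e0)//.
  apply: le_lt_trans (GG _ _ n0n) _; have := hn0 n0 (leqnn _).
  rewrite /= sub0r normrN => /(le_lt_trans (ler_norm _)).
  by rewrite /r mulrC divfK.
have Ql : Q (l + g).
  have Glg : G n + g @[n --> \oo] --> l + g by apply: cvgD => //; exact: cvg_cst.
  have := @closed_cvg _ _ \oo _ (fun n => G n + g) Q clQ _ _ Glg.
  by apply; apply: nearW => n; exact: KG.
have ld : `|l| ^+ 2 <= d.
  have h : `|G n| ^+ 2 - r n @[n --> \oo] --> `|l| ^+ 2 - 0 / 8.
    apply: cvgB; last by apply: cvgMl; exact: cvg_dyadic.
    exact: (cvgM (cvg_norm Gl) (cvg_norm Gl)).
  rewrite mul0r subr0 in h; apply: (cvgr_to_le h).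
  by apply: nearW => n; rewrite lerBlDr.
have lmin a : Q (a + g) -> `|l| ^+ 2 <= `|a| ^+ 2.
  move=> Qa; apply: le_trans ld _; apply/ler_addgt0Pr => e /dlow[n /(_ a Qa)].
  by rewrite lerBlDr.
have var a : Q (a + g) -> 0 <= dot l (a - l).
  move=> Qa; rewrite leNgt; apply/negP => neg.
  set p := - dot l (a - l); have p0 : 0 < p by rewrite /p oppr_gt0.
  set D := `|a - l| ^+ 2; have D0 : 0 <= D by rewrite /D exprn_ge0.
  have D1 : 0 < D + 1 by rewrite ltr_wpDl.
  (* A step short enough that [k * D <= p]: moving from [l] towards [a] would then strictly decrease
     the norm. The [+ 1] covers [D = 0]. *)
  pose k := Num.min 1 (p / (D + 1)).
  have k0 : 0 < k by rewrite lt_min ltr01 divr_gt0.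
  have k1 : k <= 1 by rewrite ge_min lexx.
  have kD : k * D <= p.
    have kp : k <= p / (D + 1) by rewrite ge_min lexx orbT.
    have : k * (D + 1) <= p by rewrite -ler_pdivlMr.
    by apply: le_trans; rewrite ler_pM2l// lerDl.
  have := lmin _ (Kcomb _ _ _ Qa Ql (ltW k0) k1).
  rewrite (_ : k *: a + (1 - k) *: l = l + k *: (a - l)); last first.
    by rewrite scalerBl scalerBr scale1r addrCA.
  rewrite (sqr_normD hdot) dotZr normrZ exprMn (gtr0_norm k0) -/D -addrA lerDl.
  have -> : 2 * (k * dot l (a - l)) + k ^+ 2 * D = k * (k * D - 2 * p).
    by rewrite /p; ring.
  by rewrite pmulr_rge0// => h; move: kD p0 h; lra.
have l0 : 0 < `|l| ^+ 2.
  rewrite exprn_gt0// normr_gt0; apply/eqP => l0; apply: nQg.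
  by move: Ql; rewrite l0 add0r.
exists (- l), (dot g (- l) - `|l| ^+ 2 / 2); split; last by move: l0; lra.
move=> q Qq; have := var (q - g); rewrite subrK => /(_ Qq).
rewrite !dotE -hdot !(dotC _ l); move: l0; lra.
Qed.

End separation.

(** * Differentiation of primitives *)

Lemma derivable1E (R : realType) (V : normedModType R) (f : R -> V) a :
  derivable f a 1 = cvg (h^-1 *: (f (h + a) - f a) @[h --> 0^']).
Proof.
rewrite /derivable; set g := (fun h : R => _); set k := (fun h : R => _).
suff -> : g = k by [].
by apply/funext => h; rewrite /g /k /= [h%:A]mulr1.
Qed.

Section bochner_ftc.
Context (R : realType) (H : completeNormedModType R) (dot : {dot H for idfun}).
Hypothesis hdot : induces_norm dot.
Local Notation mu := (@lebesgue_measure R).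

Lemma itv_finite_measure (a b : R) : (mu `[a, b] < +oo)%E.
Proof. by rewrite lebesgue_measure_itv/=; case: ifP => // _; rewrite -EFinB ltry. Qed.

Lemma bounded_itv_integrable (p : R -> R) (a b M : R) : measurable_fun setT p ->
  (forall t, `|p t| <= M) -> mu.-integrable `[a, b] (EFin \o p).
Proof.
move=> mp pM; apply: (@bounded_integrable _ _ R mu `[a, b] _ _ p M mp pM);
  first exact: measurable_itv.
exact: itv_finite_measure.
Qed.

Lemma simple_limit_dot (u : R -> H) v :
  simple_limit u -> measurable_fun setT (fun t => dot (u t) v).
Proof. exact: (simple_limit_measurable (@dot_continuous _ _ _ hdot v)). Qed.

Variables (u x : R -> H) (M T : R).
Hypotheses (T0 : 0 < T) (lu : simple_limit u) (uM : forall t, `|u t| <= M).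
Hypothesis xu : forall t, 0 <= t <= T -> forall v,
  dot (x t - x 0) v = \int[mu]_(s in `[0, t]) dot (u s) v.

Let p y s := `|u s - y|.

Let mp y : measurable_fun setT (p y).
Proof.
apply: simple_limit_norm; apply: simple_limitB => //.
by apply: simple_limit_finite; exact: finite_valued_cst.
Qed.

Let pM y s : `|p y s| <= M + `|y|.
Proof. by rewrite normr_id; apply: le_trans (ler_normB _ _) _; rewrite lerD2r. Qed.

(** The left-hand vector is weakly the integral of [u - y] over the interval from [s] to [t]. The
    bound is an increment of a scalar primitive, to which the real differentiation theorem
    applies. *)
Lemma primitive_increment_le y s t : 0 <= s -> s <= t -> t <= T ->
  `|x t - x s - (t - s) *: y| <=
  \int[mu]_(r in `[0, t]) p y r - \int[mu]_(r in `[0, s]) p y r.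
Proof.
move=> s0 st tT.
have ip r : mu.-integrable `[0, r] (EFin \o p y) := bounded_itv_integrable 0 r (mp y) (pM y).
have iu v r : mu.-integrable `[0, r] (EFin \o (fun s => dot (u s) v)).
  apply: (@bounded_itv_integrable _ _ _ (M * `|v|)); first exact: simple_limit_dot.
  by move=> t'; apply: le_trans (cauchy_schwarz hdot _ _) _; rewrite ler_wpM2r.
have sub : `]s, t] `<=` `[0, t] by move=> r /=; rewrite !in_itv/= => /andP[sr ->];
  rewrite (le_trans s0)// ltW.
have iS (q : R -> R) : mu.-integrable `[0, t] (EFin \o q) -> mu.-integrable `]s, t] (EFin \o q).
  by apply: integrableS.
rewrite Rintegral_itvB ?bnd_simp//.
apply: (le_norm_dot hdot); first by apply: Rintegral_ge0 => r _; rewrite normr_ge0.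
move=> v.
have -> : x t - x s = (x t - x 0) - (x s - x 0) by rewrite opprB addrA subrK.
rewrite dotBl dotBl !xu ?s0 ?(le_trans s0 st) ?(le_trans st tT)//.
rewrite Rintegral_itvB ?bnd_simp//.
have muI : fine (mu `]s, t]) = t - s.
  rewrite lebesgue_measure_itv/= lte_fin; case: ifPn => //=.
  by rewrite -leNgt => ts; apply/eqP; rewrite eq_sym subr_eq0 eq_le ts.
have ic : mu.-integrable `]s, t] (EFin \o (fun=> dot y v)).
  apply: iS; apply: (@bounded_itv_integrable _ _ _ `|dot y v|) => //; exact: measurable_cst.
rewrite dotZl mulrC -muI -(Rintegral_cst mu)//.
rewrite -RintegralB//; last exact: iS.
rewrite -RintegralZr//; last exact: iS.
have ipv : mu.-integrable `]s, t] (EFin \o (fun r => p y r * `|v|)).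
  by apply: (integrableZr _ `|v| (iS _ (ip t))).
apply: le_Rintegral => //.
  by have := integrableB _ (iS _ (iu v t)) ic; apply.
by move=> r _; rewrite -dotBl; exact: dot_le.
Qed.

(** Outside countably many null sets all the primitives of [|u - Y n|] are differentiable at [t].
    For [Y n] within [e / 2] of [u t], the difference quotient of [x] is as close to [Y n] as that
    of the scalar primitive is to 0, and the latter tends to [|u t - Y n|]. *)
Lemma primitive_derivable :
  {ae mu, forall t, 0 < t < T -> derivable x t 1 /\ derive1 x t = u t}.
Proof.
have [Y Yd] := simple_limit_dense lu.
pose F n (t : R) := \int[mu]_(r in `[0, t]) p (Y n) r.
have FTC n : {ae mu, forall t, 0 < t ->
    derivable (F n) t 1 /\ derive1 (F n) t = p (Y n) t}.
  have := @FTC1 R (p (Y n)) (BLeft 0).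
  have h1 y : mu.-integrable [set` Interval (BLeft 0) (BRight y)] (EFin \o p (Y n)).
    exact: (bounded_itv_integrable 0 y (mp _) (pM _)).
  have h2 : locally_integrable [set: R] (p (Y n)).
    split; [exact: mp|exact: openT|move=> K _ cK].
    have : mu.-integrable K (EFin \o p (Y n)).
      apply: (@bounded_integrable _ _ R mu K _ _ (p (Y n)) _ (mp _) (pM _)).
        exact: compact_measurable.
      exact: compact_finite_measure.
    by move=> /integrableP[].
  move=> /(_ h1 h2) /=; apply: filterS; first exact: (ae_filter_ringOfSetsType mu).
  move=> t h t0; by apply: h; rewrite lte_fin.
have := ae_foralln FTC; apply: filterS => t ht /andP[t0 tT].
suff cv : h^-1 *: (x (h + t) - x t) @[h --> 0^'] --> u t.
  split; last exact/cvg_lim.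
  by rewrite derivable1E; apply/cvg_ex; exists (u t).
apply/cvgrPdist_lt => e e0.
have e2 : 0 < e / 2 by rewrite divr_gt0.
have [n Yn] := Yd t _ e2.
have [Fd F'] := ht n t0.
have Fcv : h^-1 *: (F n (h + t) - F n t) @[h --> 0^'] --> p (Y n) t.
  by rewrite -F'; move: Fd; rewrite derivable1E.
have Fe : \forall h \near 0^', `|h^-1 *: (F n (h + t) - F n t)| < e / 2.
  have /cvgrPdist_lt := Fcv.
  have pe : 0 < e / 2 - p (Y n) t by rewrite subr_gt0.
  move=> /(_ _ pe); apply: filterS => h.
  rewrite distrC => hh; rewrite -[X in `|X|](subrK (p (Y n) t)).
  apply: le_lt_trans (ler_normD _ _) _; rewrite [X in _ + X]ger0_norm ?normr_ge0//.
  by rewrite -ltrBrDr.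
near=> h.
have hle : `|h| <= Num.min t (T - t).
  by near: h; apply: dnbhs0_le; rewrite lt_min t0 subr_gt0.
have [ht0 htT] : 0 <= h + t /\ h + t <= T.
  move: hle; rewrite le_min !ler_norml => /andP[/andP[h1 _] /andP[_ h2]].
  by split; move: h1 h2; lra.
have inc : `|x (h + t) - x t - h *: Y n| <= `|F n (h + t) - F n t|.
  have [h0|h0] := leP 0 h.
    have := @primitive_increment_le (Y n) t (h + t) (ltW t0) _ htT.
    by rewrite lerDr addrK => /(_ h0) /le_trans; apply; exact: ler_norm.
  have := @primitive_increment_le (Y n) (h + t) t ht0 _ (ltW tT).
  rewrite gerDr (ltW h0) opprD addrCA subrr addr0 => /(_ isT).
  rewrite scaleNr opprK -normrN !opprD !opprK [- x t + _]addrC => h1.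
  by apply: le_trans h1 _; rewrite distrC; exact: ler_norm.
have h0 : h != 0 by near: h; exact: nbhs_dnbhs_neq.
have q : `|h^-1 *: (x (h + t) - x t) - Y n| < e / 2.
  have -> : h^-1 *: (x (h + t) - x t) - Y n = h^-1 *: (x (h + t) - x t - h *: Y n).
    by rewrite [RHS]scalerBr scalerA mulVf// scale1r.
  apply: le_lt_trans (_ : `|h^-1 *: (F n (h + t) - F n t)| < _); last by near: h.
  by rewrite !normrZ ler_wpM2l.
rewrite (splitr e); apply: le_lt_trans (ler_distD (Y n) _ _) _.
by rewrite ltrD// distrC.
Unshelve. all: by end_near. Qed.

End bochner_ftc.

(** * Passage to the limit in the two inclusions *)

Section limits.
Context (R : realType) (H : completeNormedModType R) (dot : {dot H for idfun}).
Hypothesis hdot : induces_norm dot.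

Lemma hausdorff_dist_point (A B : set H) (r e : R) y :
  (hausdorff_dist A B <= r%:E)%E -> A y -> 0 < e ->
  exists2 w, B w & `|y - w| <= r + e.
Proof.
move=> hAB Ay e0.
have dB : (dist B y < (r + e)%:E)%E.
  apply: le_lt_trans (_ : r%:E < _)%E; last by rewrite lte_fin ltrDl.
  apply: le_trans hAB; rewrite /hausdorff_dist le_max; apply/orP; left.
  by apply: ereal_sup_ubound; exists y.
have [_ [w Bw <-]] := ereal_inf_lt dB.
by rewrite lte_fin => /ltW; exists w.
Qed.

(** Some element of [A] has norm at most [r + 1], so [|y|^2 <= (r + 1)^2 + g], and this is at most
    [(r + 1 + g)^2]. *)
Lemma approx_proj0_norm_le (A : set H) (g r : R) (y : H) : 0 <= r -> 0 < g ->
  (ereal_inf [set `|w|%:E | w in A] <= r%:E)%E -> approx_proj g A 0 y ->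
  `|y| <= r + 1 + g.
Proof.
move=> r0 g0 Ar /approx_proj_le[_ ylt].
have Ar1 : (ereal_inf [set `|w|%:E | w in A] < (r + 1)%:E)%E.
  by apply: le_lt_trans Ar _; rewrite lte_fin ltrDl.
have [_ [w Aw <-]] := ereal_inf_lt Ar1; rewrite lte_fin => /ltW wr.
have := ylt w Aw; rewrite !sub0r !normrN => yw.
rewrite -ler_sqr ?nnegrE ?addr_ge0// ?(ltW g0)//.
have w2 : `|w| ^+ 2 <= (r + 1) ^+ 2 by rewrite ler_sqr ?nnegrE ?addr_ge0.
have := mulr_ge0 r0 (ltW g0); have := mulr_ge0 (ltW g0) (ltW g0).
by move: w2 yw; rewrite !expr2; nra.
Qed.

(** The last hypothesis says, in terms of half-spaces, that [g] lies in the closed convex hull of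
    every tail of [phi]. If [g] were outside [Q x], a separating half-space would by upper
    semicontinuity miss [Q (p n)] for all large [n]. *)
Lemma selection_limit (Q : H -> set H) (p f phi : nat -> H) (x g : H) :
  (forall y, closed (Q y)) -> (forall y, convex_set (Q y)) -> Q x !=set0 ->
  usc_strong_weak Q -> p n @[n --> \oo] --> x -> (forall n, Q (p n) (f n)) ->
  phi n - f n @[n --> \oo] --> (0 : H) ->
  (forall v c, (\forall n \near \oo, dot (phi n) v <= c) -> dot g v <= c) ->
  Q x g.
Proof.
move=> clQ cQ Qx0 usc px Qpf phif hull; apply: contrapT => nQg.
have [v [c [Qc cg]]] := strict_separation hdot (clQ x) (cQ x) Qx0 nQg.
have clD := usc _ (@weakly_closed_half_space _ _ _ hdot v c).
have opD : open (~` [set y | Q y `&` [set w | c <= dot w v] !=set0]) by exact: closed_openC.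
have nx : (~` [set y | Q y `&` [set w | c <= dot w v] !=set0]) x.
  by move=> /= [w [Qw /=]]; rewrite leNgt => /negP; apply; exact: Qc.
have fc : \forall n \near \oo, dot (f n) v < c.
  have pD : \forall n \near \oo, ~ (Q (p n) `&` [set w | c <= dot w v] !=set0).
    exact: px (open_nbhs_nbhs (conj opD nx)).
  apply: filterS pD => n h.
  by rewrite ltNge; apply/negP => cf; apply: h; exists (f n).
(* The values [f n] are below level [c], but [phi n] only approaches them; the half-way level
   absorbs the difference. *)
have : dot g v <= (c + dot g v) / 2.
  apply: hull; have e0 : 0 < (dot g v - c) / 2 by rewrite divr_gt0// subr_gt0.
  have h0 : dot (phi n - f n) v @[n --> \oo] --> dot 0 v by exact: cvg_dotl.
  rewrite dot0l in h0; have /cvgrPdist_lt/(_ _ e0) := h0.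
  move: fc; apply: filterS2 => n fc; rewrite sub0r normrN => /(le_lt_trans (ler_norm _)).
  by rewrite dotBl; move: fc; lra.
by move: cg; lra.
Qed.

(** For a fixed test point [y] the Frechet inequality is a half-space condition on the normal. It
    holds for [xi n] with a radius independent of [n], after [y] is moved into [C (s n)], hence for
    [zeta n] up to [c], and so for [l]. *)
Lemma normal_limit (I : set R) (C : R -> set H) (L M : R) (t : R) (s : nat -> R)
    (w xi zeta : nat -> H) (x l : H) :
  equi_uniformly_subsmooth dot I C -> 0 <= L -> 0 < M ->
  (forall t s, I t -> I s -> (hausdorff_dist (C t) (C s) <= (L * `|t - s|)%:E)%E) ->
  I t -> (forall n, I (s n)) -> s n @[n --> \oo] --> t -> w n @[n --> \oo] --> x ->
  (forall n, clarke_normal_cone dot (C (s n)) (w n) (xi n)) ->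
  (forall n, `|xi n| <= M) -> zeta n - xi n @[n --> \oo] --> (0 : H) -> C t x ->
  (forall v c, (\forall n \near \oo, dot (zeta n) v <= c) -> dot l v <= c) ->
  clarke_normal_cone dot (C t) x l.
Proof.
move=> sub L0 M0 hC It Is st wx nxi xiM zxi Ctx hull.
apply: (frechet_clarke_normal hdot Ctx) => e e0.
have [delta d0 hd] := subsmooth_normal_le sub M0 e0.
(* The other half of [delta] pays for replacing [y] and [x] by [q n] and [w n]. *)
exists (delta / 2); first by rewrite divr_gt0.
move=> y Cy yx; apply/ler_addgt0Pr => c c0; apply: hull.
have ey n : exists q, C (s n) q /\ `|y - q| <= L * `|t - s n| + harmonic n.
  have [q Cq yq] := hausdorff_dist_point (hC _ _ It (Is n)) Cy (harmonic_gt0 n).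
  by exists q.
have [q qP] := choice ey.
have yq0 : y - q n @[n --> \oo] --> (0 : H).
  apply/norm_cvg0P.
  apply: (@squeeze_cvgr _ _ _ _ (fun=> 0) (fun n => L * `|t - s n| + harmonic n)).
  - by apply: nearW => n; rewrite normr_ge0 (qP n).2.
  - exact: cvg_cst.
  - have : L * `|t - s n| + harmonic n @[n --> \oo] --> L * `|t - t| + 0.
      apply: cvgD; last exact: cvg_harmonic.
      by apply: cvgMr; apply: cvg_norm; apply: cvgB => //; exact: cvg_cst.
    by rewrite subrr normr0 mulr0 addr0.
have wx0 : x - w n @[n --> \oo] --> (0 : H).
  by rewrite -(subrr x); apply: cvgB => //; exact: cvg_cst.
pose D n := `|y - q n| + `|x - w n|.
have D0 : D n @[n --> \oo] --> 0.
  have : D n @[n --> \oo] --> `|0 : H| + `|0 : H| by apply: cvgD; exact: cvg_norm.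
  by rewrite !normr0 addr0.
have z0 : `|zeta n - xi n| * `|y - x| + (e + M) * D n @[n --> \oo] --> 0.
  have : `|zeta n - xi n| * `|y - x| + (e + M) * D n @[n --> \oo] -->
      `|0 : H| * `|y - x| + (e + M) * 0.
    by apply: cvgD; [apply: cvgMl; exact: cvg_norm|exact: cvgMr].
  by rewrite normr0 mul0r mulr0 addr0.
have d2 : 0 < delta / 2 by rewrite divr_gt0.
have /cvgrPdist_lt/(_ _ c0) := z0; have /cvgrPdist_lt/(_ _ d2) := D0.
apply: filterS2 => n; rewrite !sub0r !normrN => /(le_lt_trans (ler_norm _)) Dn.
move=> /(le_lt_trans (ler_norm _)) zn.
have qw : `|(q n - w n) - (y - x)| <= D n.
  rewrite (_ : q n - w n - (y - x) = (x - w n) - (y - q n)); last first.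
    by rewrite !opprB [LHS]addrACA [RHS]addrACA [x + _]addrC.
  by apply: le_trans (ler_normB _ _) _; rewrite addrC.
have qwd : `|q n - w n| <= `|y - x| + D n.
  by rewrite -[X in `|X| <= _](subrK (y - x)) addrC; apply: le_trans (ler_normD _ _) _;
    rewrite lerD2l.
have h1 : dot (xi n) (q n - w n) <= e * `|q n - w n|.
  apply: (hd _ (Is n)) => //; [exact: (nxi n).1|exact: (qP n).1|].
  by apply: le_trans qwd _; move: Dn yx; lra.
have -> : dot (zeta n) (y - x) = dot (zeta n - xi n) (y - x)
   + dot (xi n) (q n - w n) - dot (xi n) (q n - w n - (y - x)).
  by rewrite [dot _ (_ - (y - x))]dotBr dotBl; ring.
have h2 := dot_le hdot (zeta n - xi n) (y - x).
have h3 := dot_ge hdot (xi n) (q n - w n - (y - x)).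
have h4 : `|xi n| * `|q n - w n - (y - x)| <= M * D n by exact: ler_pM.
have h5 : e * `|q n - w n| <= e * (`|y - x| + D n) by rewrite ler_pM2l.
move: zn; rewrite mulrDl; move: h5; rewrite mulrDr; move: h1 h2 h3 h4; lra.
Qed.

End limits.

(** * Compactness of almost Lipschitz sequences *)

Lemma extract_subsequence (P : nat -> nat -> Prop) :
  (forall N k, exists2 n, (N <= n)%N & P k n) ->
  exists2 phi : nat -> nat, increasing_seq phi & forall k, P k (phi k).
Proof.
move=> hP.
have hq (Nk : nat * nat) : exists n, (Nk.1 <= n)%N /\ P Nk.2 n.
  by have [n Nn Pn] := hP Nk.1 Nk.2; exists n.
have [q qP] := choice hq.
pose phi := fix phi k := if k is k'.+1 then q ((phi k').+1, k) else q (0%N, 0%N).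
exists phi.
  by apply/increasing_seqP => n; exact: (qP ((phi n).+1, n.+1)).1.
by case=> [|k]; [exact: (qP (0, 0)%N).2|exact: (qP ((phi k).+1, k.+1)).2].
Qed.

Section ascoli.
Context (R : realType) (V : normedModType R) (T K : R) (d : nat -> R).
Context (A : R -> set V) (p xs : nat -> R -> V).
Hypotheses (T0 : 0 < T) (K0 : 0 <= K) (d0 : d n @[n --> \oo] --> 0).
Hypothesis lip : forall n s t, 0 <= s <= T -> 0 <= t <= T ->
  `|xs n t - xs n s| <= K * `|t - s| + d n.
Hypothesis cA : forall t, 0 <= t <= T -> compact (A t).
Hypothesis Ap : forall n t, 0 <= t <= T -> A t (p n t) /\ `|xs n t - p n t| <= d n.

Lemma ultra_compact_cvg (U : set_system nat) (u : nat -> V) (B : set V) :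
  UltraFilter U -> compact B -> (forall n, B (u n)) -> exists l : V, u n @[n --> U] --> l.
Proof.
move=> UU cB Bu.
have [l [_ cl]] := cB (u @ U) _ (filterE _ Bu).
exists l => W Wl.
have [//|nW] := in_ultra_setVsetC (u @^-1` W) UU.
by have [y []] := cl (~` W) W nW Wl.
Qed.

(** An ultrafilter finer than [\oo] selects the limits at all times at once, in place of a diagonal
    extraction. The curves are Lipschitz and close to compact sets only up to [d n], which
    disappears in the limit. *)
Lemma ascoli_lipschitz : exists (phi : nat -> nat) (x : R -> V), [/\ increasing_seq phi,
  forall e, 0 < e -> \forall n \near \oo, forall t, 0 <= t <= T ->
    `|x t - xs (phi n) t| < e &
  forall s t, 0 <= s <= T -> 0 <= t <= T -> `|x t - x s| <= K * `|t - s| ].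
Proof.
have [U [UU ooU]] := ultraFilterLemma (@eventually_filter).
have dU : d n @[n --> U] --> 0 by move=> W /d0; exact: ooU.
have xl t : exists l : V, 0 <= t <= T -> xs n t @[n --> U] --> l.
  have [tT|tT] := pselect (0 <= t <= T); last by exists 0.
  have [l pl] := ultra_compact_cvg UU (cA tT) (fun n => (Ap n tT).1).
  exists l => _.
  have xp : xs n t - p n t @[n --> U] --> (0 : V).
    apply/norm_cvg0P; apply: (@squeeze_cvgr _ _ _ _ (fun=> 0) d) => //.
    - by apply: nearW => n; rewrite normr_ge0 (Ap n tT).2.
    - exact: cvg_cst.
  have : (xs n t - p n t) + p n t @[n --> U] --> 0 + l by exact: cvgD.
  by rewrite add0r; under eq_fun do rewrite subrK.
have [x xP] := choice xl.
have xlip s t : 0 <= s <= T -> 0 <= t <= T -> `|x t - x s| <= K * `|t - s|.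
  move=> sT tT.
  have h : `|xs n t - xs n s| - d n @[n --> U] --> `|x t - x s| - 0.
    by apply: cvgB => //; apply: cvg_norm; apply: cvgB; exact: xP.
  rewrite subr0 in h; apply: (cvgr_to_le h).
  by apply: nearW => n; rewrite lerBlDr lip.
have unif e : 0 < e -> \forall n \near U, forall t, 0 <= t <= T -> `|x t - xs n t| < e.
  move=> e0; have e4 : 0 < e / 4 by rewrite divr_gt0.
  (* The four quarters of [e]: the variation of [x] and that of [xs n] to the nearest node on the
     left, the error at the node, and [d n]. *)
  have [N N0 NK] : exists2 N, (0 < N)%N & K * T / N%:R < e / 4.
    exists (Num.truncn (K * T / (e / 4))).+1 => //.
    by rewrite ltr_pdivrMr ?ltr0n// [ltRHS]mulrC -ltr_pdivrMr// truncnS_gt.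
  pose tau (i : 'I_N.+1) : R := i%:R * (T / N%:R).
  have N0' : 0 < N%:R :> R by rewrite ltr0n.
  have tauT i : 0 <= tau i <= T.
    rewrite /tau mulr_ge0 ?divr_ge0 ?(ltW T0)//= mulrA ler_pdivrMr// mulrC ler_wpM2l ?(ltW T0)//.
    by rewrite ler_nat -ltnS.
  have net : \forall n \near U, forall i, `|x (tau i) - xs n (tau i)| < e / 4.
    apply: filter_forall => i; have /cvgrPdist_lt := xP _ (tauT i); exact.
  have dn : \forall n \near U, `|0 - d n| < e / 4 by have /cvgrPdist_lt := dU; apply.
  apply: filterS2 net dn => n net; rewrite sub0r normrN => /(le_lt_trans (ler_norm _)) dn t tT.
  have [i ti] : exists i, `|t - tau i| <= T / N%:R.
    have TN0 : 0 < T / N%:R by rewrite divr_gt0.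
    pose k := Num.truncn (t / (T / N%:R)).
    have /andP[k1 k2] : k%:R <= t / (T / N%:R) < k.+1%:R.
      by apply: truncn_itv; rewrite divr_ge0 ?(ltW TN0)//; case/andP: tT.
    have kN : (k < N.+1)%N.
      rewrite ltnS -(ler_nat R); apply: le_trans k1 _.
      rewrite ler_pdivrMr// mulrC divfK ?gt_eqF//; by case/andP: tT.
    exists (Ordinal kN); rewrite /tau /=.
    rewrite ler_pdivlMr// in k1; rewrite ltr_pdivrMr// -natr1 mulrDl mul1r in k2.
    by rewrite ger0_norm ?subr_ge0// lerBlDl ltW.
  have neti := net i.
  have h1 := xlip _ _ (tauT i) tT; have h2 := lip n tT (tauT i).
  rewrite (distrC (tau i)) in h2.
  have h3 : K * `|t - tau i| <= K * T / N%:R by rewrite -mulrA ler_wpM2l.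
  have -> : x t - xs n t = (x t - x (tau i)) + (x (tau i) - xs n (tau i)) + (xs n (tau i) - xs n t).
    by rewrite [RHS]addrA [x t - _ + (_ - _)]addrA !subrK.
  apply: le_lt_trans (ler_normD _ _) _.
  apply: le_lt_trans (_ : _ <= `|x t - x (tau i)| + `|x (tau i) - xs n (tau i)| + `|xs n (tau i) - xs n t|) _.
    by rewrite lerD2r ler_normD.
  by move: h1 h2 h3 neti dn NK; lra.
(* A set of the ultrafilter meets every tail, which turns convergence along [U] into convergence of
   a subsequence. *)
have [N k|phi phi_inc phiP] := @extract_subsequence (fun k n => forall t, 0 <= t <= T ->
    `|x t - xs n t| < harmonic k).
  have UN : U [set n | (N <= n)%N] by apply: ooU; exists N.
  have [n [Nn hn]] := filter_ex (filterI UN (unif _ (harmonic_gt0 k))).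
  by exists n.
exists phi, x; split => // e e0.
have /cvgrPdist_lt/(_ _ e0) := @cvg_harmonic R.
apply: filterS => k; rewrite sub0r normrN => /(le_lt_trans (ler_norm _)) ke t tT.
exact: lt_trans (phiP k t tT) ke.
Qed.

End ascoli.

(** * The limit velocity *)

Section limit_velocity.
Context (R : realType) (H : completeNormedModType R) (dot : {dot H for idfun}).
Hypothesis hdot : induces_norm dot.
Local Notation mu := (@lebesgue_measure R).

Lemma midpoint_hull_dot_le (U : Type) (Phi : nat -> (U -> H) * (U -> H))
    (G : nat -> (U -> H) * (U -> H)) (t : U) (l1 l2 : H) :
  (forall j, midpoint_hull Phi j (G j)) ->
  (G j).1 t @[j --> \oo] --> l1 -> (G j).2 t @[j --> \oo] --> l2 ->
  (forall v c, (\forall n \near \oo, dot ((Phi n).1 t) v <= c) -> dot l1 v <= c) /\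
  (forall v c, (\forall n \near \oo, dot ((Phi n).2 t) v <= c) -> dot l2 v <= c).
Proof.
move=> KG G1 G2.
have hullP (s : (U -> H) * (U -> H) -> H) v c N :
    (forall a b, s (2^-1 *: (a + b)) = 2^-1 *: (s a + s b)) ->
    (forall n, (N <= n)%N -> dot (s (Phi n)) v <= c) ->
    forall j, (N <= j)%N -> dot (s (G j)) v <= c.
  move=> slin sc j Nj; have := midpoint_hull_antitone Nj (KG j).
  elim=> [m|a b _ IHa _ IHb]; first exact: sc.
  by rewrite slin dotZl dotDl; move: IHa IHb; lra.
have d1 v : dot ((G j).1 t) v @[j --> \oo] --> dot l1 v by exact: cvg_dotl.
have d2 v : dot ((G j).2 t) v @[j --> \oo] --> dot l2 v by exact: cvg_dotl.
split=> v c [N _ hN].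
  apply: (cvgr_to_le (d1 v)); exists N => // j Nj.
  exact: (hullP (fun a => a.1 t) v c N _ hN).
apply: (cvgr_to_le (d2 v)); exists N => // j Nj.
exact: (hullP (fun a => a.2 t) v c N _ hN).
Qed.

Variables (T K : R) (phi zeta xs : nat -> R -> H) (x : R -> H) (e : nat -> R).
Hypotheses (T0 : 0 < T) (fphi : forall n, finite_valued (phi n))
  (fzeta : forall n, finite_valued (zeta n)).
Hypotheses (phiK : forall n t, `|phi n t| <= K) (zetaK : forall n t, `|zeta n t| <= K).
Hypothesis xsx : forall t, 0 <= t <= T -> xs n t @[n --> \oo] --> x t.
Hypothesis e0 : e n @[n --> \oo] --> 0.
Hypothesis prim : forall n t v, 0 <= t <= T ->
  `|dot (xs n t - xs n 0) v - \int[mu]_(s in `[0, t]) dot (phi n s - zeta n s) v| <= e n * `|v|.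

Let Phi n := (phi n, zeta n).

Lemma limit_velocity : exists (G : nat -> (R -> H) * (R -> H)) (g1 g2 : R -> H),
  (forall j, midpoint_hull Phi j (G j)) /\
  {ae mu, forall t, 0 < t < T ->
     [/\ (G j).1 t @[j --> \oo] --> g1 t, (G j).2 t @[j --> \oo] --> g2 t,
         derivable x t 1 & derive1 x t = g1 t - g2 t]}.
Proof.
have mI (a b : R) : measurable `[a, b]%classic by exact: measurable_itv.
have [G [g1 [g2 [KG [l1 l2] gK aeG]]]] := @midpoint_hull_cvg _ _ R mu `[0, T]%classic
  (mI _ _) (itv_finite_measure 0 T) H dot hdot Phi K
  (fun n => conj (fphi n) (fzeta n)) (fun n t => conj (phiK n t) (zetaK n t)).
have fG j := @midpoint_hull_finite _ _ R H Phi (fun n => conj (fphi n) (fzeta n)) j _ (KG j).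
have GK j := @midpoint_hull_bound _ _ R H Phi K (fun n t => conj (phiK n t) (zetaK n t)) j _ (KG j).
pose u t := g1 t - g2 t.
have lu : simple_limit u by exact: simple_limitB.
have uK t : `|u t| <= K + K.
  by have [h1 h2] := gK t; apply: le_trans (ler_normB _ _) _; exact: lerD.
have xu t : 0 <= t <= T -> forall v, dot (x t - x 0) v = \int[mu]_(s in `[0, t]) dot (u s) v.
  move=> tT v; have /andP[t0 tT'] := tT; set L := dot (x t - x 0) v.
  pose I (a : (R -> H) * (R -> H)) := \int[mu]_(s in `[0, t]) dot (a.1 s - a.2 s) v.
  have iI (a : (R -> H) * (R -> H)) : finite_valued a.1 -> finite_valued a.2 ->
      mu.-integrable `[0, t] (EFin \o (fun s => dot (a.1 s - a.2 s) v)).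
    exact: (@integrable_finite_valued2 _ _ R mu `[0, t]%classic (mI _ _)
      (itv_finite_measure 0 t) H (fun y z => dot (y - z) v)).
  (* The set of pairs [a] with [|L - I a| <= r] is stable under midpoints and contains a tail of
     [Phi], hence the hull of that tail. *)
  have near_I r : 0 < r -> exists N, forall j, (N <= j)%N -> `|L - I (G j)| <= r.
    move=> r0.
    have r2 : 0 < r / 2 by rewrite divr_gt0.
    have h1 : dot (xs n t - xs n 0) v @[n --> \oo] --> L.
      by apply: cvg_dotl => //; apply: cvgB; apply: xsx => //; rewrite lexx ltW.
    have h2 : e n * `|v| @[n --> \oo] --> 0 * `|v| by exact: cvgMl.
    rewrite mul0r in h2.
    have [N _ hN] : \forall n \near \oo, `|L - I (Phi n)| <= r.
      move/cvgrPdist_lt : h1 => /(_ _ r2); move/cvgrPdist_lt : h2 => /(_ _ r2).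
      apply: filterS2 => n; rewrite sub0r normrN => /(le_lt_trans (ler_norm _)) a1 a2.
      have := prim n v tT; rewrite -/(I (Phi n)) => a3.
      apply: le_trans (ler_distD (dot (xs n t - xs n 0) v) _ _) _.
      by move: a1 a2 a3; lra.
    exists N => j Nj; have := midpoint_hull_antitone Nj (KG j).
    elim=> [m|a b Ka IHa Kb IHb]; first exact: hN.
    have [fa1 fa2] := @midpoint_hull_finite _ _ R H Phi (fun n => conj (fphi n) (fzeta n)) _ _ Ka.
    have [fb1 fb2] := @midpoint_hull_finite _ _ R H Phi (fun n => conj (fphi n) (fzeta n)) _ _ Kb.
    have -> : I (2^-1 *: (a + b)) = 2^-1 * (I a + I b).
      rewrite /I -RintegralD//; [|exact: iI|exact: iI].
      rewrite -RintegralZl//.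
        apply: eq_Rintegral => s _ /=; rewrite -scalerBr dotZl -dotDl.
        by rewrite opprD addrACA.
      exact: (@integrableD _ _ R mu `[0, t]%classic (mI 0 t) _ _ (iI a fa1 fa2) (iI b fb1 fb2)).
    have -> : L - 2^-1 * (I a + I b) = 2^-1 * ((L - I a) + (L - I b)) by field.
    rewrite normrM normfV (ger0_norm (ler0n _ 2)) ler_pdivrMl//.
    by apply: le_trans (ler_normD _ _) _; move: IHa IHb; lra.
  have cvI : I (G j) @[j --> \oo] --> \int[mu]_(s in `[0, t]) dot (u s) v.
    apply: (@bounded_Rintegral_cvg _ _ R mu `[0, t]%classic (mI _ _) (itv_finite_measure 0 t)
      (fun j s => dot ((G j).1 s - (G j).2 s) v) (fun s => dot (u s) v) ((K + K) * `|v|)).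
    - move=> n; apply: (simple_limit_dot hdot); apply: simple_limit_finite.
      exact: (finite_valued_comp2 (fun y z : H => y - z) (fG n).1 (fG n).2).
    - exact: (simple_limit_dot hdot).
    - move=> n s; apply: le_trans (cauchy_schwarz hdot _ _) _; rewrite ler_wpM2r//.
      by have [h1 h2] := GK n s; apply: le_trans (ler_normB _ _) _; exact: lerD.
    - apply: filterS aeG => s h st.
      have [h1 h2] : (G j).1 s @[j --> \oo] --> g1 s /\ (G j).2 s @[j --> \oo] --> g2 s.
        by apply: h; move: st; rewrite /= !in_itv/= => /andP[-> /le_trans]; apply.
      by apply: cvg_dotl => //; exact: cvgB.
  suff : `|L - \int[mu]_(s in `[0, t]) dot (u s) v| <= 0.
    by rewrite normr_le0 subr_eq0 => /eqP.
  apply/ler_addgt0Pr => r r0; rewrite add0r.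
  have [N hN] := near_I _ r0.
  have h : `|L - I (G j)| @[j --> \oo] --> `|L - \int[mu]_(s in `[0, t]) dot (u s) v|.
    by apply: cvg_norm; apply: cvgB => //; exact: cvg_cst.
  by apply: (cvgr_to_le h); exists N.
exists G, g1, g2; split=> //.
have := primitive_derivable hdot lu uK xu.
move: aeG; apply: filterS2 => t h1 h2 tT.
have /andP[t0 tT'] := tT.
have [//|G1 G2] := h1; first by rewrite /= in_itv/= !ltW.
by have [] := h2 tT.
Qed.

End limit_velocity.

(** * The catching-up algorithm *)

(** Shifting by [c / L] makes the recursion homogeneous with ratio [1 + L * m], and
    [1 + L * m <= expR (L * m)]. *)
Lemma gronwall_discrete (R : realType) (e : nat -> R) (m c L T : R) (N : nat) :
  0 < L -> 0 <= c -> 0 <= m -> N%:R * m <= T -> e 0%N = 0 ->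
  (forall k, (k < N)%N -> e k.+1 <= e k + m * (c + L * e k)) ->
  forall k, (k <= N)%N -> e k <= c / L * expR (L * T).
Proof.
move=> L0 c0 m0 NT e0 eS.
have h k : (k <= N)%N -> e k + c / L <= (1 + L * m) ^+ k * (c / L).
  elim: k => [|k IH] kN; first by rewrite e0 add0r expr0 mul1r.
  apply: le_trans (_ : (1 + L * m) * (e k + c / L) <= _).
    have cE : c = L * (c / L) by field; rewrite gt_eqF.
    rewrite (le_trans (_ : _ <= e k + m * (L * (c / L) + L * e k) + c / L))//.
      by rewrite lerD2r -cE; exact: eS.
    by rewrite le_eqVlt; apply/orP; left; apply/eqP; ring.
  rewrite exprS -mulrA; apply: ler_wpM2l; last exact: IH (ltnW kN).
  by rewrite addr_ge0// mulr_ge0// ltW.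
move=> k kN; apply: le_trans (_ : e k + c / L <= _); first by rewrite lerDl divr_ge0// ltW.
apply: le_trans (h k kN) _; rewrite mulrC ler_wpM2l ?divr_ge0 ?(ltW L0)//.
apply: le_trans (_ : expR (L * m) ^+ k <= _).
  by rewrite lerXn2r ?nnegrE ?expR_ge0 ?expR_ge1Dx// addr_ge0// mulr_ge0// ltW.
rewrite -expRM_natl ler_expR mulrCA ler_wpM2l ?(ltW L0)//.
by apply: le_trans NT; rewrite ler_wpM2r// ler_nat.
Qed.

(** * Step functions on a time grid and their primitives *)

Section step_functions.
Context (R : realType) (H : completeNormedModType R) (dot : {dot H for idfun}).
Hypothesis hdot : induces_norm dot.
Local Notation mu := (@lebesgue_measure R).
Context (tau : nat -> R).
Hypothesis tau_le : forall i j, (i <= j)%N -> tau i <= tau j.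

(** The cells are open on the left, as in the interpolation; the value is 0 outside them, in
    particular at the initial node. *)
Fixpoint step (v : nat -> R -> H) (m : nat) (t : R) : H :=
  if m is k.+1 then
    if t \in `]tau k, tau k.+1]%classic then v k t else step v k t
  else 0.

Lemma step_in v m k t : (k < m)%N -> tau k < t <= tau k.+1 -> step v m t = v k t.
Proof.
elim: m => // m IH; rewrite ltnS leq_eqVlt => /predU1P[-> tk|km /[dup] tk /andP[_ tk1]] /=.
  by rewrite mem_set//= in_itv/=.
rewrite memNset ?IH//= in_itv/= => /andP[tm _].
by have := le_lt_trans (tau_le km) tm; rewrite ltNge tk1.
Qed.

Lemma step_finite_valued v m :
  (forall k, (k < m)%N -> finite_valued (v k)) -> finite_valued (step v m).
Proof.
elim: m => [|m IH] fv; first exact: finite_valued_cst.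
apply: finite_valued_if; first exact: measurable_itv.
  exact: fv.
by apply: IH => k km; apply: fv; exact: ltnW.
Qed.

Lemma step_bound v m M t : 0 <= M -> (forall k, (k < m)%N -> forall t, `|v k t| <= M) ->
  `|step v m t| <= M.
Proof.
move=> M0; elim: m => [|m IH] vM /=; first by rewrite normr0.
by case: ifP => _; [exact: vM|apply: IH => k km; apply: vM; exact: ltnW].
Qed.

(** On each cell the contribution of [zeta k] is integrated exactly, so only the replacement of
    [a k] by the integral of [s k] costs [r]. *)
Lemma step_primitive (N : nat) (m r : R) (z a zeta : nat -> H) (s : nat -> R -> H) :
  tau 0 = 0 -> (forall k, tau k.+1 = tau k + m) -> 0 <= m ->
  (forall k, (k < N)%N -> finite_valued (s k)) ->
  (forall k, (k < N)%N -> z k.+1 - z k = a k - m *: zeta k) ->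
  (forall k, (k < N)%N -> forall v, `|dot (a k) v -
     \int[mu]_(t in `[tau k, tau k.+1]) dot (s k t) v| <= r * `|v|) ->
  forall v k, (k <= N)%N ->
  `|dot (z k - z 0) v - \int[mu]_(t in `[0, tau k])
     dot (step s N t - step (fun k _ => zeta k) N t) v| <= k%:R * r * `|v|.
Proof.
move=> tau0 tauS m0 fs zS ar v.
pose q t := dot (step s N t - step (fun k _ => zeta k) N t) v.
have fz k : finite_valued (fun _ : R => zeta k) by exact: finite_valued_cst.
have fS : finite_valued (step s N) by exact: step_finite_valued.
have fZ : finite_valued (step (fun k _ => zeta k) N).
  by apply: step_finite_valued => k _; exact: fz.
have iq b c : mu.-integrable `[b, c] (EFin \o q).
  apply: (@integrable_finite_valued2 _ _ R mu `[b, c]%classic (measurable_itv _)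
    (itv_finite_measure b c) H (fun y z => dot (y - z) v) _ _ fS fZ).
elim=> [|k IH] kN.
  rewrite subrr dot0l tau0 set_itv1 Rintegral_set1 subrr normr0.
  by rewrite !mul0r.
have tk : tau k <= tau k.+1 by exact: tau_le.
have tk0 : 0 <= tau k by rewrite -tau0; exact: tau_le.
have splitI : \int[mu]_(t in `[0, tau k.+1]) q t =
    \int[mu]_(t in `[0, tau k]) q t + \int[mu]_(t in `]tau k, tau k.+1]) q t.
  have := @Rintegral_itvB R q (BLeft 0) (BRight (tau k.+1)) (tau k) (iq 0 (tau k.+1)).
  by rewrite !bnd_simp => /(_ tk0 tk) <-; rewrite addrC subrK.
have muI : fine (mu `[tau k, tau k.+1]) = m.
  rewrite lebesgue_measure_itv/= lte_fin tauS ltrDl.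
  case: ltP => /= m0'; first by rewrite addrAC subrr add0r.
  by apply/eqP; rewrite eq_le m0 m0'.
have is_ : mu.-integrable `[tau k, tau k.+1] (EFin \o (fun t => dot (s k t) v)).
  apply: (@integrable_finite_valued _ _ R mu `[tau k, tau k.+1]%classic (measurable_itv _)
    (itv_finite_measure _ _) H (fun y => dot y v) _ (fs k kN)).
have ic : mu.-integrable `[tau k, tau k.+1] (EFin \o (fun t => dot (zeta k) v)).
  apply: (@integrable_finite_valued _ _ R mu `[tau k, tau k.+1]%classic (measurable_itv _)
    (itv_finite_measure _ _) H (fun y => dot y v) _ (fz k)).
have lastI : \int[mu]_(t in `]tau k, tau k.+1]) q t =
    \int[mu]_(t in `[tau k, tau k.+1]) dot (s k t) v - m * dot (zeta k) v.
  transitivity (\int[mu]_(t in `]tau k, tau k.+1]) (dot (s k t) v - dot (zeta k) v)).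
    apply: eq_Rintegral => t /set_mem /=; rewrite in_itv/= => tt.
    by rewrite /q !(step_in _ kN tt) dotBl.
  rewrite Rintegral_itv_obnd_cbnd; last first.
    apply: (@integrableS _ _ R mu `[tau k, tau k.+1]%classic) => //.
      by move=> t /=; rewrite !in_itv/= => /andP[/ltW -> ->].
    exact: (@integrableB _ _ R mu `[tau k, tau k.+1]%classic (measurable_itv _) _ _ is_ ic).
  by rewrite RintegralB// Rintegral_cst// muI [m * _]mulrC.
rewrite -/q splitI lastI.
have -> : z k.+1 - z 0 = (z k - z 0) + (a k - m *: zeta k).
  by rewrite -zS// [RHS]addrC addrA subrK.
rewrite dotDl (dotBl dot (a k)) dotZl -natr1 !mulrDl mul1r.
set A := dot (z k - z 0) v; set B := \int[mu]_(t in `[0, tau k]) q t.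
set D := \int[mu]_(t in `[tau k, tau k.+1]) _.
have -> : A + (dot (a k) v - m * dot (zeta k) v) - (B + (D - m * dot (zeta k) v)) =
    (A - B) + (dot (a k) v - D) by ring.
by apply: le_trans (ler_normD _ _) _; apply: lerD; [exact: IH (ltnW kN)|exact: ar].
Qed.

End step_functions.

(** * A priori estimates, uniform in the step size *)

Section catching_up_estimates.
Context (R : realType) (H : completeNormedModType R) (dot : {dot H for idfun}).
Hypothesis hdot : induces_norm dot.
Local Notation mu := (@lebesgue_measure R).
Context (T : R) (C : R -> set H) (LC : R) (h : H -> R) (Lh gamma : R) (f : R -> H -> H).
Hypotheses (hT : 0 < T) (hLC : 0 <= LC) (hLh : 0 < Lh) (hgamma : 0 < gamma).
Hypothesis hCLip : forall t s : R, t \in `[0, T] -> s \in `[0, T] ->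
  (hausdorff_dist (C t) (C s) <= (LC * `|t - s|)%:E)%E.
Hypotheses (h_ge0 : forall x, 0 <= h x) (h_lip : Lh.-lipschitz (h : H -> R^o)).
Hypothesis f_bound : forall x, {ae mu, forall t : R, t \in `[0, T] ->
  `|f t x| <= h x + 1 + gamma}.
Hypothesis f_meas : forall x, strongly_measurable mu `[0, T] (f ^~ x).
Hypothesis hbc : forall t : R, t \in `[0, T] -> ball_compact (C t).
Context (x0 : H) (hx0 : C 0 x0) (eps : nat -> R).
Context (z : nat -> nat -> H) (xn : nat -> R -> H).
Hypothesis halg : catching_up T C f eps x0 z xn.

(** The Gronwall bound for [|z n k - x0|]: an increment is at most
    [2 * (h (z n k) + 2 + gamma) + LC + 2] times the step, and [h (z n k)] is at most
    [h x0 + Lh * |z n k - x0|]. *)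
Definition growth_radius : R :=
  (LC + 2 * (h x0 + 2 + gamma) + 2) / (2 * Lh) * expR (2 * Lh * T).

Definition drift_bound : R := h x0 + 2 + gamma + Lh * growth_radius.

Definition speed_bound : R := 2 * drift_bound + LC + 2.

Let f_bound_itv a b x : 0 <= a -> b <= T ->
  {ae mu, forall t : R, `[a, b]%classic t -> `|f t x| <= h x + 1 + gamma}.
Proof.
move=> a0 bT; apply: (@filterS _ _ (ae_filter_ringOfSetsType mu) _ _ _ (f_bound x)) =>
  t ft; rewrite /= in_itv/= => /andP[at_ tb].
by apply: ft; rewrite in_itv/= (le_trans a0)// (le_trans tb).
Qed.

Let f_meas_itv a b x : 0 <= a -> b <= T -> strongly_measurable mu `[a, b]%classic (f ^~ x).
Proof.
move=> a0 bT; have [s fs sf] := f_meas x; exists s => //.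
apply: (@filterS _ _ (ae_filter_ringOfSetsType mu) _ _ _ sf) => t st;
  rewrite /= in_itv/= => /andP[at_ tb].
by apply: st; rewrite /= in_itv/= (le_trans a0)// (le_trans tb).
Qed.

Let b_ge0 x : 0 <= h x + 1 + gamma.
Proof. by rewrite addr_ge0 ?(ltW hgamma)// addr_ge0. Qed.

Lemma integral_itv_approx a b x e : 0 <= a -> b <= T -> 0 < e ->
  exists s, [/\ finite_valued s, forall t, `|s t| <= h x + 1 + gamma + 1,
    exists2 E, measurable E /\ (mu E <= e%:E)%E &
      forall t, `[a, b]%classic t -> ~ E t -> `|f t x - s t| <= e &
    forall u, `|dot (integral_itv a b (f ^~ x)) u - \int[mu]_(t in `[a, b]) dot (s t) u|
      <= e * `|u|].
Proof.
move=> a0 bT e0.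
exact: (@bochner_approx _ _ R mu `[a, b]%classic (measurable_itv _) (itv_finite_measure a b)
  H dot hdot (f ^~ x) _ e (b_ge0 x) (f_meas_itv x a0 bT) (f_bound_itv x a0 bT) e0).
Qed.

(** The estimate is read off the finite-valued approximants, whose bound exceeds that of [f] by 1;
    hence 2 in place of 1. *)
Lemma norm_integral_itv_le a b x : 0 <= a -> a <= b -> b <= T ->
  `|integral_itv a b (f ^~ x)| <= (h x + 2 + gamma) * (b - a).
Proof.
move=> a0 ab bT; apply/ler_addgt0Pr => e e0.
have B0 : 0 <= h x + 1 + gamma + 1 by rewrite addr_ge0.
have [s [fs sB _ sI]] := integral_itv_approx x a0 bT e0.
apply: (le_norm_dot hdot).
  by rewrite addr_ge0 ?(ltW e0)// mulr_ge0 ?subr_ge0// addr_ge0 ?(ltW hgamma)// addr_ge0.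
move=> v; have muI : fine (mu `[a, b]) = b - a.
  rewrite lebesgue_measure_itv/= lte_fin; case: ltP => //= ba.
  by apply/eqP; rewrite eq_sym subr_eq0 eq_le ab ba.
have is_ : mu.-integrable `[a, b] (EFin \o (fun t => dot (s t) v)).
  exact: (@integrable_finite_valued _ _ R mu `[a, b]%classic (measurable_itv _)
    (itv_finite_measure _ _) H (fun y => dot y v) _ fs).
have h1 : \int[mu]_(t in `[a, b]) dot (s t) v <= (h x + 1 + gamma + 1) * `|v| * (b - a).
  rewrite -muI; apply: (@le_Rintegral_bound _ _ R mu `[a, b]%classic (measurable_itv _)
    (itv_finite_measure a b) _ _ is_) => t _.
  by apply: le_trans (dot_le hdot _ _) _; rewrite ler_wpM2r.
have := le_trans (ler_norm _) (sI v); rewrite lerBlDr => h2; apply: le_trans h2 _.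
rewrite mulrDl addrC lerD2r; apply: le_trans h1 _.
by rewrite le_eqVlt; apply/orP; left; apply/eqP; ring.
Qed.

Section one_resolution.
Variable n : nat.
Hypothesis n0 : (0 < n)%N.
Local Notation m := (time_step T n).
Local Notation tau := (time_node T n).
Hypothesis eps_le : eps n <= m ^+ 2.

Let m0 : 0 < m. Proof. by rewrite divr_gt0// ltr0n. Qed.

Lemma time_node0 : tau 0 = 0. Proof. by rewrite /time_node mul0r. Qed.

Lemma time_nodeS k : tau k.+1 = tau k + m.
Proof. by rewrite /time_node -natr1 mulrDl mul1r. Qed.

Lemma time_node_le i j : (i <= j)%N -> tau i <= tau j.
Proof. by move=> ij; rewrite /time_node ler_wpM2r ?(ltW m0)// ler_nat. Qed.

Lemma time_node_last : tau n = T.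
Proof. by rewrite /time_node /time_step mulrC divfK// pnatr_eq0 -lt0n. Qed.

Lemma time_node_itv k : (k <= n)%N -> 0 <= tau k <= T.
Proof.
move=> kn; apply/andP; split.
  by have := time_node_le (leq0n k); rewrite time_node0.
by have := time_node_le kn; rewrite time_node_last.
Qed.

Lemma exists_time_node t : 0 < t <= T ->
  exists2 k, (k < n)%N & tau k < t <= tau k.+1.
Proof.
move=> /andP[t0 tT].
have ex : exists k, t <= tau k by exists n; rewrite time_node_last.
case: (ex_minnP ex) => -[|k]; first by rewrite time_node0 leNgt t0.
move=> tk kmin; exists k; first by apply: kmin; rewrite time_node_last.
rewrite tk andbT ltNge; apply/negP => /kmin; by rewrite ltnn.
Qed.

Local Notation a k := (integral_itv (tau k) (tau k.+1) (f ^~ (z n k))).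
Local Notation y k := (z n k + a k).

Lemma z0E : z n 0%N = x0. Proof. by have [] := halg n0. Qed.

Lemma z_mem k : (k <= n)%N -> C (tau k) (z n k).
Proof.
case: k => [|k] kn; first by rewrite time_node0 z0E.
by have [_ /(_ k kn)/approx_proj_le[]] := halg n0.
Qed.

Lemma z_min k w : (k < n)%N -> C (tau k.+1) w ->
  `|y k - z n k.+1| ^+ 2 < `|y k - w| ^+ 2 + eps n.
Proof.
move=> kn; have [_ zP _ _] := halg n0.
by have [_] := approx_proj_le (zP k kn); exact.
Qed.

Let B k := h (z n k) + 2 + gamma.

Let B_ge0 k : 0 <= B k.
Proof. by rewrite addr_ge0 ?(ltW hgamma)// addr_ge0. Qed.

Lemma integral_step_le k : (k < n)%N -> `|a k| <= B k * m.
Proof.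
move=> kn; have := time_node_itv (ltnW kn) => /andP[k0 _].
have := time_node_itv kn => /andP[_ k1].
apply: le_trans (norm_integral_itv_le (z n k) k0 (time_node_le (leqnSn k)) k1) _.
by rewrite time_nodeS [tau k + m]addrC addrK.
Qed.

(** The competitor is a point of the next set within [(LC + 1) * m] of [z n k], the extra [m]
    because the distance may not be attained. The tolerance [eps n <= m ^+ 2] adds at most one more
    [m] after taking roots. *)
Lemma projection_step_le k : (k < n)%N -> `|y k - z n k.+1| <= (B k + LC + 2) * m.
Proof.
move=> kn.
have tk i : (i <= n)%N -> tau i \in `[0, T] by move=> /time_node_itv; rewrite in_itv.
have [w Cw zw] := hausdorff_dist_point (hCLip (tk _ (ltnW kn)) (tk _ kn)) (z_mem (ltnW kn)) m0.
have dm : `|tau k - tau k.+1| = m.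
  by rewrite time_nodeS opprD addrA subrr add0r normrN gtr0_norm.
rewrite dm in zw.
have yw : `|y k - w| <= (B k + LC + 1) * m.
  rewrite addrAC; apply: le_trans (ler_normD _ _) _.
  by have := integral_step_le kn; move: zw; lra.
have K0 : 0 <= (B k + LC + 1) * m by rewrite mulr_ge0 ?(ltW m0)// addr_ge0// addr_ge0.
rewrite -ler_sqr ?nnegrE//; last by rewrite mulr_ge0 ?(ltW m0)// addr_ge0// addr_ge0.
apply: le_trans (ltW (z_min kn Cw)) _.
apply: le_trans (_ : ((B k + LC + 1) * m) ^+ 2 + m ^+ 2 <= _).
  by apply: lerD => //; rewrite ler_sqr ?nnegrE.
rewrite -subr_ge0 (_ : _ - _ = 2 * (((B k + LC + 1) * m) * m)); last by ring.
by rewrite mulr_ge0// mulr_ge0// ltW.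
Qed.

Lemma z_increment_le k : (k < n)%N -> `|z n k.+1 - z n k| <= (2 * B k + LC + 2) * m.
Proof.
move=> kn; rewrite -(subrK (y k) (z n k.+1)) -addrA [y k - _]addrAC subrr add0r.
apply: le_trans (ler_normD _ _) _; rewrite distrC.
have := integral_step_le kn; have := projection_step_le kn; lra.
Qed.

Lemma z_growth k : (k <= n)%N -> `|z n k - x0| <= growth_radius.
Proof.
have hb x : h x <= h x0 + Lh * `|x - x0|.
  have := @h_lip (x, x0) (conj I I) => /= hh.
  by rewrite -lerBlDl; apply: le_trans (ler_norm _) hh.
rewrite /growth_radius; apply: (@gronwall_discrete R (fun k => `|z n k - x0|) m _ _ _ n).
- by rewrite mulr_gt0.
- rewrite addr_ge0// addr_ge0// mulr_ge0// addr_ge0 ?(ltW hgamma)// addr_ge0//.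
- exact: ltW.
- by have := time_node_last; rewrite /time_node => ->.
- by rewrite z0E subrr normr0.
- move=> k' kn; apply: le_trans (ler_distD (z n k') _ _) _.
  rewrite addrC lerD2l; apply: le_trans (z_increment_le kn) _.
  rewrite mulrC ler_wpM2l ?(ltW m0)//.
  by rewrite /B; have := hb (z n k'); lra.
Qed.

Lemma drift_le k : (k <= n)%N -> B k <= drift_bound.
Proof.
move=> kn; have := @h_lip (z n k, x0) (conj I I) => /= hh.
have := le_trans (ler_norm _) hh; rewrite lerBlDl => h1.
have : Lh * `|z n k - x0| <= Lh * growth_radius by rewrite ler_pM2l// z_growth.
by rewrite /B /drift_bound; move: h1; lra.
Qed.

Local Notation K := speed_bound.

Let drift0 : 0 <= drift_bound.
Proof. exact: le_trans (B_ge0 0) (drift_le (leq0n n)). Qed.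

Let K0 : 0 <= K.
Proof. by rewrite /speed_bound; move: drift0 hLC; lra. Qed.

Let drift_speed : drift_bound <= K.
Proof. by rewrite /speed_bound; move: drift0 hLC; lra. Qed.

Lemma projection_step_speed k : (k < n)%N -> `|y k - z n k.+1| <= K * m.
Proof.
move=> kn; apply: le_trans (projection_step_le kn) _; rewrite ler_wpM2r ?(ltW m0)//.
by have := drift_le (ltnW kn); rewrite /speed_bound; move: drift0; lra.
Qed.

Lemma z_increment_speed k : (k < n)%N -> `|z n k.+1 - z n k| <= K * m.
Proof.
move=> kn; apply: le_trans (z_increment_le kn) _; rewrite ler_wpM2r ?(ltW m0)//.
by have := drift_le (ltnW kn); rewrite /speed_bound; lra.
Qed.

Lemma xn_near_z k t : (k < n)%N -> tau k < t <= tau k.+1 ->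
  `|xn n t - z n k| <= 2 * K * m.
Proof.
move=> kn tk; have [_ _ _ xnE] := halg n0.
have /andP[t1 t2] := tk.
have /andP[tau0 _] := time_node_itv (ltnW kn).
have /andP[_ tauT] := time_node_itv kn.
rewrite (xnE k t kn) ?in_itv// -[z n k + _ + _]addrA [z n k + _]addrC addrK.
apply: le_trans (ler_normD _ _) _.
have h1 : `|(t - tau k) / m| <= 1.
  rewrite ger0_norm; last by apply: divr_ge0; [rewrite subr_ge0 ltW|exact: ltW].
  by rewrite ler_pdivrMr// mul1r lerBlDl -time_nodeS.
have h2 : `|((t - tau k) / m) *: (z n k.+1 - z n k - a k)| <= K * m.
  have -> : z n k.+1 - z n k - a k = - (y k - z n k.+1) by rewrite opprB opprD addrA.
  rewrite normrZ normrN -[leRHS]mul1r; apply: ler_pM => //.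
  exact: projection_step_speed.
have h3 : `|integral_itv (tau k) t (f ^~ (z n k))| <= K * m.
  apply: le_trans (norm_integral_itv_le (z n k) tau0 (ltW t1) (le_trans t2 tauT)) _.
  apply: ler_pM; [exact: B_ge0|by rewrite subr_ge0 ltW| |].
    by apply: le_trans drift_speed; exact: drift_le (ltnW kn).
  by rewrite lerBlDl -time_nodeS.
by move: h2 h3; lra.
Qed.

Lemma exists_near_z t : 0 <= t <= T ->
  exists2 k, (k < n)%N & tau k <= t <= tau k.+1 /\ `|xn n t - z n k| <= 2 * K * m.
Proof.
move=> /andP[t0 tT]; have [tpos|] := ltP 0 t; last first.
  move=> t0'; have -> : t = 0 by apply/eqP; rewrite eq_le t0 t0'.
  exists 0%N => //; split.
    by rewrite time_node0 lexx (time_nodeS 0) time_node0 add0r (ltW m0).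
  have [_ _ -> _] := halg n0; rewrite z0E subrr normr0.
  by apply: mulr_ge0; [exact: mulr_ge0|exact: ltW].
have [k kn tk] : exists2 k, (k < n)%N & tau k < t <= tau k.+1.
  by apply: exists_time_node; rewrite tpos.
by exists k => //; split; [case/andP: tk => /ltW -> ->|exact: xn_near_z].
Qed.

Lemma z_speed i j : (i <= j)%N -> (j <= n)%N -> `|z n j - z n i| <= K * (tau j - tau i).
Proof.
move=> /subnKC <-; move: (j - i)%N => l; elim: l => [|l IH].
  by rewrite addn0 !subrr normr0 mulr0.
rewrite addnS => iln; apply: le_trans (ler_distD (z n (i + l)) _ _) _.
rewrite time_nodeS; have := z_increment_speed iln; have := IH (ltnW iln); lra.
Qed.

(** Both points are compared with nodes: [2 * K * m] at each end, and one [K * m] for rounding the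
    times. *)
Lemma xn_almost_lipschitz s t : 0 <= s <= T -> 0 <= t <= T ->
  `|xn n t - xn n s| <= K * `|t - s| + 5 * K * m.
Proof.
wlog st : s t / s <= t.
  move=> wl sT tT; have [|/ltW] := leP s t; first by move=> ?; exact: wl.
  by move=> ts; rewrite distrC [in leRHS]distrC; exact: wl.
move=> sT tT; rewrite (ger0_norm (_ : 0 <= t - s)) ?subr_ge0//.
have [i iN [/andP[i1 i2] xi]] := exists_near_z sT.
have [j jN [/andP[j1 j2] xj]] := exists_near_z tT.
have zji : `|z n j - z n i| <= K * (t - s + m).
  have [ij|/ltnW ji] := leqP i j.
    apply: le_trans (z_speed ij (ltnW jN)) _; rewrite ler_wpM2l//.
    by move: i2 j1; rewrite time_nodeS; lra.
  rewrite distrC; apply: le_trans (z_speed ji (ltnW iN)) _; rewrite ler_wpM2l//.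
  by move: i1 j2; rewrite time_nodeS; lra.
apply: le_trans (ler_distD (z n j) _ _) _.
have := ler_distD (z n i) (z n j) (xn n s); rewrite (distrC (z n i) (xn n s)).
by move: xi xj zji; lra.
Qed.

Lemma xn_near_C t : 0 <= t <= T ->
  exists2 p, C t p /\ `|p| <= `|x0| + growth_radius + K * T & `|xn n t - p| <= 3 * K * m.
Proof.
move=> tT; have [k kn [/andP[k1 k2] xk]] := exists_near_z tT.
have tk : tau k \in `[0, T] by rewrite in_itv/=; exact: time_node_itv (ltnW kn).
have tT' : t \in `[0, T] by rewrite in_itv.
have [p Cp zp] := hausdorff_dist_point (hCLip tk tT') (z_mem (ltnW kn)) m0.
have d : `|tau k - t| <= m by rewrite distrC ger0_norm ?subr_ge0// lerBlDl -time_nodeS.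
have {}zp : `|z n k - p| <= K * m.
  apply: le_trans zp _.
  have : LC * `|tau k - t| <= LC * m by rewrite ler_wpM2l.
  have : (LC + 1) * m <= K * m.
    by rewrite ler_wpM2r ?(ltW m0)// /speed_bound; move: drift0; lra.
  by rewrite mulrDl; lra.
have mT : m <= T.
  rewrite /time_step ler_pdivrMr ?ltr0n// ler_peMr ?(ltW hT)//.
  by rewrite (ler_nat _ 1).
exists p; last first.
  apply: le_trans (ler_distD (z n k) _ _) _; move: xk zp; lra.
split=> //.
have := z_growth (ltnW kn).
have h1 : `|p| <= `|z n k| + `|z n k - p|.
  by rewrite -[X in `|X| <= _](subKr (z n k)); exact: ler_normB.
have h2 : `|z n k| <= `|x0| + `|z n k - x0|.
  by rewrite -{1}(subrK x0 (z n k)) addrC; exact: ler_normD.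
have : K * m <= K * T by rewrite ler_wpM2l.
by move: h1 h2 zp; lra.
Qed.

(** All that the limit passage uses about one resolution. In the primitive relation, [4 * K * m]
    pays twice [2 * K * m] for rounding [t] down to a node: once in [xn] and once in the
    integral. *)
Lemma discrete_velocity e : 0 < e -> exists (phi zeta : R -> H) (E : set R),
  [/\ finite_valued phi /\ finite_valued zeta,
     forall t, `|phi t| <= K /\ `|zeta t| <= K,
     measurable E /\ (mu E <= e%:E)%E,
     forall t v, 0 <= t <= T ->
       `|dot (xn n t - xn n 0) v - \int[mu]_(s in `[0, t]) dot (phi s - zeta s) v|
       <= (4 * K * m + e) * `|v| &
     forall t, 0 < t <= T -> exists (q w xi : H) (s : R),
       [/\ `|xn n t - q| <= 2 * K * m, ~ E t -> `|phi t - f t q| <= e,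
           0 <= s <= T /\ `|t - s| <= m,
           [/\ clarke_normal_cone dot (C s) w xi, `|xi| <= K + 2 &
             `|zeta t - xi| <= 2 * Num.sqrt (eps n / m ^+ 2)] &
           `|xn n t - w| <= (3 * K + 1) * m]].
Proof.
move=> e0; have n0R : 0 < n%:R :> R by rewrite ltr0n.
(* Per-cell tolerance: over the [n] cells both the measures of the exceptional sets and the integral
   errors add up to at most [e]. *)
have en0 : 0 < e / n%:R by rewrite divr_gt0.
have hs k : exists s E, (k < n)%N -> [/\ finite_valued s, forall t, `|s t| <= K,
    measurable E /\ (mu E <= (e / n%:R)%:E)%E,
    forall t, tau k <= t <= tau k.+1 -> ~ E t -> `|f t (z n k) - s t| <= e &
    forall u, `|dot (a k) u - \int[mu]_(t in `[tau k, tau k.+1]) dot (s t) u|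
      <= e / n%:R * `|u| ].
  have [kn|kn] := ltnP k n; last by exists (fun=> 0), set0.
  have /andP[k0 _] := time_node_itv (ltnW kn); have /andP[_ k1] := time_node_itv kn.
  have [s [fs sB [E [mE muE] sE] sI]] := integral_itv_approx (z n k) k0 k1 en0.
  exists s, E => _; split => //.
  - move=> t; apply: le_trans (sB t) _; apply: le_trans drift_speed.
    by have := drift_le (ltnW kn); rewrite /B; lra.
  - move=> t tk Et; apply: le_trans (sE t _ Et) _; first by rewrite /= in_itv.
    by rewrite ler_pdivrMr// ler_peMr ?(ltW e0)// (ler_nat _ 1).
have [s hs1] := choice hs; have [E hE] := choice hs1.
pose ze k : H := m^-1 *: (y k - z n k.+1).
have zeK k : (k < n)%N -> `|ze k| <= K.
  move=> kn; rewrite normrZ normfV (gtr0_norm m0) ler_pdivrMl// mulrC.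
  exact: projection_step_speed.
pose phi := step tau s n; pose zeta := step tau (fun k (_ : R) => ze k) n.
exists phi, zeta, (\big[setU/set0]_(k < n) E k); split.
- split; apply: step_finite_valued => k kn; first by have [] := hE k kn.
  exact: finite_valued_cst.
- move=> t; split; apply: step_bound => // k kn t'; last exact: zeK.
  by have [_ ] := hE k kn.
- split; first by apply: bigsetU_measurable => i _; have [_ _ []] := hE i (ltn_ord i).
  apply: le_trans (Boole_inequality _ _) _.
    by move=> i ni; have [_ _ []] := hE i ni.
  apply: (@le_trans _ _ (\sum_(k < n) (e / n%:R)%:E)%E).
    by apply: lee_sum => i _; have [_ _ []] := hE i (ltn_ord i).
  by rewrite sumEFin sumr_const card_ord -(mulr_natr (e / n%:R)) divfK ?gt_eqF.
- move=> t v tT; have [k kn [/andP[k1 k2] xk]] := exists_near_z tT.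
  have fphi : finite_valued phi.
    by apply: step_finite_valued => i ni; have [] := hE i ni.
  have fzeta : finite_valued zeta.
    by apply: step_finite_valued => i ni; exact: finite_valued_cst.
  pose q s := dot (phi s - zeta s) v.
  have phiK t' : `|phi t'| <= K.
    by apply: step_bound => // i ni t''; have [_ ] := hE i ni.
  have zetaK t' : `|zeta t'| <= K by apply: step_bound => // i ni _; exact: zeK.
  have qK t' : `|q t'| <= 2 * K * `|v|.
    apply: le_trans (cauchy_schwarz hdot _ _) _; rewrite ler_wpM2r//.
    by apply: le_trans (ler_normB _ _) _; have := phiK t'; have := zetaK t'; lra.
  have iq b c : mu.-integrable `[b, c] (EFin \o q).
    exact: (@integrable_finite_valued2 _ _ R mu `[b, c]%classic (measurable_itv _)
      (itv_finite_measure b c) H (fun y z => dot (y - z) v) _ _ fphi fzeta).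
  have /andP[tau0 _] := time_node_itv (ltnW kn).
  have splitI : \int[mu]_(s in `[0, t]) q s =
      \int[mu]_(s in `[0, tau k]) q s + \int[mu]_(s in `]tau k, t]) q s.
    have := @Rintegral_itvB R q (BLeft 0) (BRight t) (tau k) (iq 0 t).
    by rewrite !bnd_simp => /(_ tau0 k1) <-; rewrite addrC subrK.
  have lastI : `|\int[mu]_(s in `]tau k, t]) q s| <= 2 * K * `|v| * m.
    have iq' : mu.-integrable `]tau k, t] (EFin \o q).
      apply: (@integrableS _ _ R mu `[tau k, t]%classic) => //.
      by move=> s'; rewrite /= !in_itv/= => /andP[/ltW -> ->].
    apply: le_trans (le_normr_Rintegral _ iq') _ => //.
    have iq'' : mu.-integrable `]tau k, t] (EFin \o (fun s => `|q s|)).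
      by apply: integrable_norm iq'.
    have finm : (mu `]tau k, t] < +oo)%E.
      by rewrite lebesgue_measure_itv/=; case: ifP => // _; rewrite -EFinB ltry.
    apply: le_trans (@le_Rintegral_bound _ _ R mu `]tau k, t]%classic (measurable_itv _)
      finm _ _ iq'' (fun s' _ => qK s')) _.
    have muI : fine (mu `]tau k, t]) <= m.
      rewrite lebesgue_measure_itv/= lte_fin; case: ltP => _ /=; last exact: ltW.
      by rewrite lerBlDl -time_nodeS.
    by apply: ler_wpM2l muI; rewrite !mulr_ge0.
  have [_ _ xn0 _] := halg n0.
  have := @step_primitive _ _ dot tau time_node_le n m (e / n%:R) (z n) (fun k => a k) ze s
    time_node0 time_nodeS (ltW m0) _ _ _ v k (ltnW kn).
  rewrite -/phi -/zeta -/q splitI xn0 z0E.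
  set I1 := \int[mu]_(t in `[0, tau k]) _; set I2 := \int[mu]_(t in `]tau k, t]) _ => prim.
  have {}prim : `|dot (z n k - x0) v - I1| <= e * `|v|.
    apply: le_trans (prim _ _ _) _.
    + by move=> i ni; have [] := hE i ni.
    + move=> i ni; by rewrite scalerA mulfV ?gt_eqF// scale1r opprB [RHS]addrC opprD addrA subrK.
    + by move=> i ni; have [] := hE i ni.
    + rewrite ler_wpM2r// mulrA ler_pdivrMr// mulrC ler_pM2l//.
      by rewrite ler_nat ltnW.
  have -> : dot (xn n t - x0) v - (I1 + I2) =
      dot (xn n t - z n k) v + (dot (z n k - x0) v - I1) - I2.
    by rewrite !dotBl; ring.
  apply: le_trans (ler_normB _ _) _.
  have h1 := ler_normD (dot (xn n t - z n k) v) (dot (z n k - x0) v - I1).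
  have h2 : `|dot (xn n t - z n k) v| <= 2 * K * m * `|v|.
    by apply: le_trans (cauchy_schwarz hdot _ _) _; rewrite ler_wpM2r.
  rewrite -/I2 in lastI.
  have -> : (4 * K * m + e) * `|v| = 2 * K * m * `|v| + e * `|v| + 2 * K * `|v| * m by ring.
  by move: h1 h2 prim lastI; lra.
- move=> t tT; have [k kn tk] := exists_time_node tT.
  have /andP[tk1 tk2] := tk.
  have tauS' : tau k.+1 \in `[0, T] by rewrite in_itv/=; exact: time_node_itv kn.
  have zw := fun w => @z_min k w kn.
  have [w [Sw zwe] nw] := near_projection_normal hdot (hbc tauS') (z_mem kn) zw.
  have phiE : phi t = s k t by apply: step_in => //; exact: time_node_le.
  have zetaE : zeta t = ze k by apply: step_in => //; exact: time_node_le.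
  (* Chosen so that [r * m] is the square root of [eps n], which bounds [|z n k.+1 - w|]. The
     residual and the normal vector differ by twice this vector, so dividing by [m] leaves
     [2 * r]. *)
  pose r := Num.sqrt (eps n / m ^+ 2).
  have e0' : 0 <= eps n by apply: ltW; apply: le_lt_trans zwe; rewrite exprn_ge0.
  have m2 : 0 < m ^+ 2 by rewrite exprn_gt0.
  have rm2 : (r * m) ^+ 2 = eps n.
    by rewrite exprMn sqr_sqrtr ?divr_ge0 ?(ltW m2)// divfK// gt_eqF.
  have r0 : 0 <= r by rewrite sqrtr_ge0.
  have r1 : r <= 1 by rewrite -[leRHS]sqrtr1 ler_sqrt// ler_pdivrMr// mul1r.
  have {}zwe : `|z n k.+1 - w| <= r * m.
    rewrite -ler_sqr ?nnegrE//; last exact: mulr_ge0 r0 (ltW m0).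
    by rewrite rm2 ltW.
  have zx : `|zeta t - m^-1 *: (y k - w + (z n k.+1 - w))| <= 2 * r.
    rewrite zetaE /ze -scalerBr normrZ normfV (gtr0_norm m0) ler_pdivrMl//.
    have -> : y k - z n k.+1 - (y k - w + (z n k.+1 - w)) = - (2 *: (z n k.+1 - w)).
      rewrite opprD addrA opprB [y k - z n k.+1 + _]addrC addrA subrK -[w - z n k.+1]opprB.
      by rewrite -opprD -mulr2n scaler_nat.
    by rewrite normrN normrZ (ger0_norm (ler0n _ 2)); move: zwe; lra.
  exists (z n k), w, (m^-1 *: (y k - w + (z n k.+1 - w))), (tau k.+1); split.
  + exact: xn_near_z.
  + move=> Et; rewrite phiE distrC; have [_ _ _ sE _] := hE k kn.
    apply: sE; first by rewrite (ltW tk1).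
    by move=> Ekt; apply: Et; rewrite -bigcup_mkord; exists k.
  + split; first exact: time_node_itv.
    by rewrite distrC ger0_norm ?subr_ge0// time_nodeS; move: tk1; lra.
  + split => //; first by apply: clarke_normalZ => //; rewrite invr_ge0 ltW.
    rewrite -[X in `|X|](subKr (zeta t)); apply: le_trans (ler_normB _ _) _.
    apply: lerD; first by rewrite zetaE zeK.
    by apply: le_trans zx _; rewrite ler_piMr.
  + apply: le_trans (ler_distD (z n k.+1) _ _) _.
    have h1 := xn_near_z kn tk; have h2 := z_increment_speed kn.
    have := ler_distD (z n k) (xn n t) (z n k.+1); rewrite (distrC (z n k)).
    have : r * m <= 1 * m by rewrite ler_wpM2r// ltW.
    by move: h1 h2 zwe; lra.
Qed.

End one_resolution.
End catching_up_estimates.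

Lemma lipschitz_absolutely_continuous (R : realType) (H : normedModType R) (a b K : R)
    (x : R -> H) : 0 <= K ->
  (forall s t, a <= s <= b -> a <= t <= b -> `|x t - x s| <= K * `|t - s|) ->
  absolutely_continuous a b x.
Proof.
move=> K0 xK e e0; have K1 : 0 < K + 1 by rewrite ltr_wpDl.
exists (e / (K + 1)); first by rewrite divr_gt0.
move=> m u v uv _ suv.
apply: (@le_lt_trans _ _ (\sum_(i < m) (K + 1) * (v i - u i))).
  apply: ler_sum => i _; have [au [uvi vb]] := uv i.
  have uI : a <= u i <= b by rewrite au (le_trans uvi).
  have vI : a <= v i <= b by rewrite vb (le_trans au).
  apply: le_trans (xK _ _ uI vI) _; rewrite ger0_norm ?subr_ge0//.
  by rewrite ler_wpM2r ?subr_ge0// lerDl.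
by rewrite -mulr_sumr mulrC -ltr_pdivlMr.
Qed.

Lemma increasing_seq_ge (phi : nat -> nat) : increasing_seq phi -> forall n, (n <= phi n)%N.
Proof.
move=> /increasing_seqP phiS; elim=> // n IH; exact: leq_ltn_trans IH (phiS n).
Qed.

Lemma cvg_subseq (T : topologicalType) (u : nat -> T) (phi : nat -> nat) (l : T) :
  increasing_seq phi -> u n @[n --> \oo] --> l -> u (phi n) @[n --> \oo] --> l.
Proof.
move=> hphi ul W /ul[N _ hN]; exists N => // n /= Nn; apply: hN => /=.
exact: leq_trans Nn (increasing_seq_ge hphi n).
Qed.

Lemma ae_lebesgue_neq (R : realType) (a : R) : {ae @lebesgue_measure R, forall t, t <> a}.
Proof.
exists [set a]; split; [exact: measurable_set1|exact: lebesgue_measure_set1|].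
by move=> t /= /contrapT.
Qed.

Theorem theorem3 (R : realType) (H : completeNormedModType R)
    (dot : {dot H for idfun}) (hdot : induces_norm dot)
    (T : R) (hT : 0 < T)
    (C : R -> set H)
    (hC0 : forall t : R, t \in `[0, T] -> C t !=set0)
    (hCcl : forall t : R, t \in `[0, T] -> closed (C t))
    (LC : R) (hLC : 0 <= LC)
    (hCLip : forall t s : R, t \in `[0, T] -> s \in `[0, T] ->
       (hausdorff_dist (C t) (C s) <= (LC * `|t - s|)%:E)%E)
    (F : R -> H -> set H)
    (hF0 : forall (t : R) (x : H), t \in `[0, T] -> F t x !=set0)
    (hFcl : forall (t : R) (x : H), t \in `[0, T] -> closed (F t x))
    (hFcvx : forall (t : R) (x : H), t \in `[0, T] -> convex_set (F t x))
    (H1 : forall t : R, t \in `[0, T] -> usc_strong_weak (F t))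
    (h : H -> R) (h_ge0 : forall x, 0 <= h x)
    (Lh : R) (hLh : 0 < Lh) (h_lip : Lh.-lipschitz (h : H -> R^o))
    (H2 : forall x, {ae @lebesgue_measure R, forall t : R, t \in `[0, T] ->
       (ereal_inf [set `|w|%:E | w in F t x] <= (h x)%:E)%E})
    (gamma : R) (hgamma : 0 < gamma)
    (f : R -> H -> H)
    (H3_sel : forall (t : R) (x : H), t \in `[0, T] -> approx_proj gamma (F t x) 0 (f t x))
    (H3_meas : forall x,
       strongly_measurable (@lebesgue_measure R) `[0, T] (f ^~ x))
    (hsub : equi_uniformly_subsmooth dot `[0, T] C)
    (hbc : forall t : R, t \in `[0, T] -> ball_compact (C t))
    (x0 : H) (hx0 : C 0 x0)
    (eps : nat -> R) (heps : forall n, (0 < n)%N -> 0 < eps n)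
    (heps_lim : eps n / time_step T n ^+ 2 @[n --> \oo] --> 0)
    (z : nat -> nat -> H) (xn : nat -> R -> H)
    (halg : catching_up T C f eps x0 z xn) :
  exists (phi : nat -> nat) (x : R -> H),
    [/\ increasing_seq phi,
        {uniform `[0, T], (fun n => xn (phi n)) @ \oo --> x} &
        sweeping_solution dot T C F x0 x].
Proof.
have fb x : {ae @lebesgue_measure R, forall t : R, t \in `[0, T] ->
    `|f t x| <= h x + 1 + gamma}.
  apply: (@filterS _ _ (ae_filter_ringOfSetsType _) _ _ _ (H2 x)) => t h2 tT.
  exact: approx_proj0_norm_le (h2 tT) (H3_sel _ _ tT).
have [N0 N0pos epsN0] : exists2 N0, (0 < N0)%N &
    forall n, (N0 <= n)%N -> eps n <= time_step T n ^+ 2.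
  have /cvgrPdist_lt/(_ _ ltr01)[N _ hN] := heps_lim.
  exists N.+1 => // n Nn; have n0 : (0 < n)%N by exact: leq_ltn_trans Nn.
  have m2 : 0 < time_step T n ^+ 2 by rewrite exprn_gt0// divr_gt0// ltr0n.
  have := hN n (ltnW Nn); rewrite /= sub0r normrN => /(le_lt_trans (ler_norm _)).
  by rewrite ltr_pdivrMr// mul1r => /ltW.
(* The shift skips the unconstrained stage 0 and the finitely many stages where [eps n] exceeds the
   squared step; the final subsequence is [nn \o psi]. *)
pose nn k := (k + N0)%N.
have nn0 k : (0 < nn k)%N by rewrite addn_gt0 N0pos orbT.
have nneps k : eps (nn k) <= time_step T (nn k) ^+ 2 by apply: epsN0; exact: leq_addl.
pose K := speed_bound T LC h Lh gamma x0.
pose m k := time_step T (nn k).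
have m0 : m k @[k --> \oo] --> 0.
  have inc : increasing_seq (fun k => (k + N0.-1)%N).
    by apply/increasing_seqP => k; rewrite ltEnat /= ltn_add2r.
  have -> : m = (fun k => T * harmonic (k + N0.-1)%N).
    by apply/funext => k; rewrite /m /time_step /nn /= -addnS prednK.
  rewrite -[X in _ --> X](mulr0 T); apply: cvgMr.
  exact: (@cvg_subseq R harmonic _ 0 inc (@cvg_harmonic R)).
have data k := discrete_velocity hdot hT hLC hLh hgamma hCLip h_ge0 h_lip fb H3_meas hbc hx0
  halg (nn0 k) (nneps k) (dyadic_gt0 R k).
have [phi data1] := choice data.
have [zeta data2] := choice data1.
have [E data3] := choice data2.
have K0 : 0 <= K by have [_ /(_ 0)[b _] _ _ _] := data3 0%N; exact: le_trans b.
pose xs k := xn (nn k).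
pose d k := 5 * K * m k.
have d0 : d k @[k --> \oo] --> 0.
  by rewrite -[X in _ --> X](mulr0 (5 * K)); exact: cvgMr.
have mpos k : 0 < m k by rewrite divr_gt0// ltr0n.
(* Points of the sets near the curves, for Ascoli; the [+ 1] keeps the radius positive, as
   [ball_compact] demands. *)
have hp (kt : nat * R) : exists p, 0 <= kt.2 <= T ->
    (C kt.2 `&` [set x | `|x| <= `|x0| + growth_radius T LC h Lh gamma x0 + K * T + 1]) p /\
    `|xs kt.1 kt.2 - p| <= d kt.1.
  have [tT|tT] := pselect (0 <= kt.2 <= T); last by exists 0.
  have [p [Cp pB] xp] := xn_near_C hdot hT hLC hLh hgamma hCLip h_ge0 h_lip fb H3_meas hx0
    halg (nn0 kt.1) (nneps kt.1) tT.
  exists p => _; split; first by split => //=; rewrite (le_trans pB)// lerDl.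
  apply: le_trans xp _; rewrite -/K -/(m kt.1) /d.
  have : 0 <= K * m kt.1 by rewrite mulr_ge0// ltW.
  by lra.
have [p pP] := choice hp.
have growth0 : 0 <= growth_radius T LC h Lh gamma x0.
  exact: le_trans (z_growth hdot hT hLC hLh hgamma hCLip h_ge0 h_lip fb H3_meas hx0
    halg (nn0 0%N) (nneps 0%N) (leq0n _)).
have [psi [x [psi_inc psix xlip]]] := @ascoli_lipschitz R H T K d
  (fun t => C t `&` [set x | `|x| <= `|x0| + growth_radius T LC h Lh gamma x0 + K * T + 1])
  (fun k t => p (k, t)) xs hT K0 d0
  (fun k s t sT tT => xn_almost_lipschitz hdot hT hLC hLh hgamma hCLip h_ge0 h_lip fb H3_meas
     hx0 halg (nn0 k) (nneps k) sT tT)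
  (fun t tT => @hbc t tT _ (ltr_wpDl (addr_ge0 (addr_ge0 (normr_ge0 _) growth0)
     (mulr_ge0 K0 (ltW hT))) ltr01))
  (fun k t => pP (k, t)).
have xsx t : 0 <= t <= T -> xs (psi n) t @[n --> \oo] --> x t.
  move=> tT; apply/cvgrPdist_lt => e /psix; apply: filterS => n; exact.
have mpsi : m (psi n) @[n --> \oo] --> 0 by exact: cvg_subseq m0.
have dpsi : d (psi n) @[n --> \oo] --> 0 by exact: cvg_subseq d0.
have dypsi : dyadic R (psi n) @[n --> \oo] --> 0 by exact: cvg_subseq (@cvg_dyadic R).
have close0 (V : normedModType R) (u v : nat -> V) (l : V) (b : nat -> R) :
    u n @[n --> \oo] --> l -> b n @[n --> \oo] --> 0 ->
    (forall n, `|u n - v n| <= b n) -> v n @[n --> \oo] --> l.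
  move=> ul b0 uvb; have uv0 : u n - v n @[n --> \oo] --> (0 : V).
    apply/norm_cvg0P; apply: (@squeeze_cvgr _ _ _ _ (fun=> 0) b) => //.
      by apply: nearW => n; rewrite normr_ge0 uvb.
    exact: cvg_cst.
  have -> : v = (fun n => u n - (u n - v n)).
    by apply/funext => n; rewrite opprB addrC subrK.
  by rewrite -(subr0 l); exact: cvgB.
have Ctx t : 0 <= t <= T -> C t (x t).
  move=> tT; have px := close0 _ _ _ _ _ (xsx t tT) dpsi (fun n => (pP (psi n, t) tT).2).
  have := @closed_cvg _ _ \oo _ (fun n => p (psi n, t)) (C t) (hCcl t tT) _ _ px.
  by apply; apply: nearW => n; have [[]] := pP (psi n, t) tT.
pose err n := 4 * K * m (psi n) + dyadic R (psi n).
have err0 : err n @[n --> \oo] --> 0.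
  rewrite -[X in _ --> X]addr0 -[X in _ --> X + _](mulr0 (4 * K)).
  by apply: cvgD => //; exact: cvgMr.
have [G [g1 [g2 [KG aeG]]]] := @limit_velocity R H dot hdot T K
  (fun n => phi (psi n)) (fun n => zeta (psi n)) (fun n => xs (psi n)) x err hT
  (fun n => let: And5 a _ _ _ _ := data3 (psi n) in a.1)
  (fun n => let: And5 a _ _ _ _ := data3 (psi n) in a.2)
  (fun n t => let: And5 _ a _ _ _ := data3 (psi n) in (a t).1)
  (fun n t => let: And5 _ a _ _ _ := data3 (psi n) in (a t).2)
  xsx err0
  (fun n t v => let: And5 _ _ _ a _ := data3 (psi n) in a t v).
(* Applied to the whole family before extraction; since [psi n >= n], the conclusion passes to the
   subsequence. *)
have aeE := @borel_cantelli_dyadic R _ _ (@lebesgue_measure R) E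
  (fun n => let: And5 _ _ a _ _ := data3 n in a.1)
  (fun n => let: And5 _ _ a _ _ := data3 n in a.2).
exists (nn \o psi), x; split.
- apply/increasing_seqP => n /=; rewrite ltEnat /= ltn_add2r.
  by move/increasing_seqP : psi_inc; apply.
- apply/uniform_cvgP => e /psix; apply: filterS => n hn t tT.
  by apply: hn; move: tT; rewrite /= in_itv.
- split.
  + exact: lipschitz_absolutely_continuous K0 xlip.
  (* The endpoints are discarded: the derivative is two-sided, and time 0 lies in no cell. *)
  + have aeT := ae_lebesgue_neq T; have ae0 := ae_lebesgue_neq (0 : R).
    have ae1 := @filterI _ _ (ae_filter_ringOfSetsType _) _ _ aeG aeE.
    have ae2 := @filterI _ _ (ae_filter_ringOfSetsType _) _ _ aeT ae0.
    apply: (@filterS2 _ _ (ae_filter_ringOfSetsType _) _ _ _ _ ae1 ae2).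
    move=> t [hG hE] [tnT tn0] tI.
    have tT : 0 < t < T.
      move: (tI); rewrite in_itv/= => /andP[t0 tT].
      by rewrite !lt_neqAle t0 tT !andbT; apply/andP; split; apply/eqP; [exact/nesym|].
    have tT' : 0 <= t <= T by move: tI; rewrite in_itv.
    have tT'' : 0 < t <= T by case/andP: tT => -> /ltW.
    have [G1 G2 dx x't] := hG tT.
    split=> //; rewrite x't.
    have [hull1 hull2] := midpoint_hull_dot_le hdot KG G1 G2.
    have loc n := let: And5 _ _ _ _ a := data3 (psi n) in a t tT''.
    have [q loc1] := choice loc; have [w loc2] := choice loc1.
    have [xi loc3] := choice loc2; have [s loc4] := choice loc3.
    exists (g2 t); last first.
      exists (g1 t); last by rewrite addrC.
      apply: (selection_limit hdot (p := q) (f := fun n => f t (q n))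
        (phi := fun n => phi (psi n) t)) => //.
      * by move=> y; exact: hFcl.
      * by move=> y; exact: hFcvx.
      * exact: hF0.
      * exact: H1.
      * apply: (close0 _ _ _ _ (fun n => 2 * K * m (psi n)) (xsx t tT')).
          by rewrite -[X in _ --> X](mulr0 (2 * K)); exact: cvgMr.
        by move=> n; have [] := loc4 n.
      * by move=> n; have [] := approx_proj_le (H3_sel _ (q n) tI).
      * apply/norm_cvg0P; apply: (@squeeze_cvgr _ _ _ _ (fun=> 0) (fun n =>
        dyadic R (psi n))) => //.
          (* Almost every [t] is outside the exceptional sets from some index on, and from there
             [phi] is within a dyadic error of [f t (q n)]. *)
          have [N hN] := hE; exists N => // n /= Nn; rewrite normr_ge0/=.
          have [_ a _ _ _] := loc4 n; apply: a; apply: hN.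
          exact: leq_trans Nn (increasing_seq_ge psi_inc n).
        exact: cvg_cst.
    apply: (normal_limit hdot hsub (L := LC) (M := K + 2) (s := s) (w := w) (xi := xi)
      (zeta := fun n => zeta (psi n) t)) => //.
    * by rewrite ltr_wpDl.
    * by move=> n; have [_ _ [sT _] _ _] := loc4 n; rewrite /= in_itv.
    * apply: (close0 _ (fun=> t) _ _ (fun n => m (psi n))) => //; first exact: cvg_cst.
      by move=> n; have [_ _ [] ] := loc4 n.
    * apply: (close0 _ _ _ _ (fun n => (3 * K + 1) * m (psi n)) (xsx t tT')).
        by rewrite -[X in _ --> X](mulr0 (3 * K + 1)); exact: cvgMr.
      by move=> n; have [] := loc4 n.
    * by move=> n; have [_ _ _ []] := loc4 n.
    * by move=> n; have [_ _ _ []] := loc4 n.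
    * apply/norm_cvg0P; apply: (@squeeze_cvgr _ _ _ _ (fun=> 0)
        (fun n => 2 * Num.sqrt (eps (nn (psi n)) / time_step T (nn (psi n)) ^+ 2))) => //.
      - by apply: nearW => n; rewrite normr_ge0/=; have [_ _ _ []] := loc4 n.
      - exact: cvg_cst.
      - rewrite -[X in _ --> X](mulr0 2); apply: cvgMr.
        have nn_inc : increasing_seq (nn \o psi).
          apply/increasing_seqP => n /=; rewrite ltEnat /= ltn_add2r.
          by move/increasing_seqP : psi_inc; apply.
        have := cvg_subseq nn_inc heps_lim => e_lim.
        by rewrite -(@sqrtr0 R); exact: (continuous_cvg _ (@sqrt_continuous R 0) e_lim).
    * exact: Ctx.
  + have T0 : 0 <= (0 : R) <= T by rewrite lexx ltW.
    have h1 : xs (psi n) 0 @[n --> \oo] --> x0.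
      have -> : (fun n => xs (psi n) 0) = (fun=> x0).
        by apply/funext => n; have [_ _ ] := halg _ (nn0 (psi n)).
      exact: cvg_cst.
    exact: (cvg_unique _ (xsx 0 T0) h1).
Qed.
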